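(* Let $(W,S)$ be a hyperbolic Coxeter system of rank three, let $w$ be a Coxeter element of $(W,S)$, let $R_0$ be the set of reflections in $[1,w]$, and let $\prec$ be an axial ordering of $R_0$. The natural labeling of $[1,w]$ by reflections ordered by $\prec$ is an EL-labeling. In other words, every element $u\in[1,w]$ has a unique $\prec$-increasing factorization into reflections (among its factorizations of minimal length), and this factorization is lexicographically minimal.
   Context: Let $m_1,m_2,m_3\in\{2,3,\dots\}\cup\{\infty\}$ be the orders of the products of the three pairs of distinct elements of $S$. $(W,S)$ is hyperbolic iff $\frac1{m_1}+\frac1{m_2}+\frac1{m_3}<1$ (with $1/\infty=0$). Then $W$ acts by isometries on the hyperbolic plane $\mathbb H^2$ as the group generated by the reflections in the sides of a triangle with angles $\pi/m_i$ (a vertex being at infinity if $m_i=\infty$), the elements of $S$ being the reflections in its sides. The reflections of $W$ are the conjugates of elements of $S$; $R$ is the set of reflections, and $l_R$ the word length in the generators $R$. For a reflection $r$, $\mathrm{Fix}(r)$ is its fixed line. A chamber is a connected component of $\mathbb H^2\setminus\bigcup_{r\in R}\mathrm{Fix}(r)$. A Coxeter element $w$ is a product of the three elements of $S$ in some order; it is a glide reflection of $\mathbb H^2$, and its axis $\ell$, oriented in the direction of translation, is the Coxeter axis. An axial chamber is a chamber whose interior meets $\ell$. The poset $[1,w]=\{u\in W\mid l_R(u)+l_R(u^{-1}w)=l_R(w)\}$ is ordered by $u\le v$ iff $l_R(u)+l_R(u^{-1}v)=l_R(v)$. Axial ordering: use the hyperboloid model $\{x_1^2+x_2^2-x_3^2=-1,\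 x_3>0\}\subseteq\mathbb R^3$, where isometries extend to linear isometries of $(\mathbb R^3,Q)$, $Q=x_1^2+x_2^2-x_3^2$. Let $P\subseteq\mathbb R^3$ be the plane spanned by $\ell$, and for a reflection $r$ let $\overline{\mathrm{Fix}}(r)\subseteq\mathbb R^3$ be the linear plane fixed by the linear extension of $r$ (the span of $\mathrm{Fix}(r)$); $\overline{\mathrm{Fix}}(r)\cap P$ is a line. Fix an axial chamber $C_0$ and a point $q\in\ell\cap C_0$. An axial ordering is a total order $\prec$ on $R_0$ with $r_1\prec r_2$ whenever $\overline{\mathrm{Fix}}(r_1)\cap P$ comes before $\overline{\mathrm{Fix}}(r_2)\cap P$ when traversing the projective line $\mathbb P(P)$ starting from the line spanned by $q$ and going in the positive direction of $\ell$; if $\overline{\mathrm{Fix}}(r_1)\cap P=\overline{\mathrm{Fix}}(r_2)\cap P$, the relative order of $r_1,r_2$ is arbitrary. The natural labeling assigns to a cover relation $u\lessdot ur$ in $[1,w]$ the reflection $r\in R_0$. EL-labeling: each saturated chain in a labeled poset yields the word of its labels; chains are compared lexicographically by their words, and a chain is increasing if its word is strictly increasing. The labeling is an EL-labeling if every interval has a unique increasing maximal chain and this chain lexicographically precedes all other maximal chains of the interval. *)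

(* Defs.v *)
From HB Require Import structures.
From mathcomp Require Import all_boot all_order all_algebra all_fingroup.
From mathcomp Require Import all_classical all_reals all_analysis.

Set Implicit Arguments.
Unset Strict Implicit.
Unset Printing Implicit Defensive.

Import Order.TTheory GRing.Theory Num.Theory.
Import numFieldNormedType.Exports.

Local Open Scope classical_set_scope.
Local Open Scope ring_scope.

Section CoxeterSystems.
Variable n : nat.

(* [None] stands for the order oo. *)
Definition coxeter_matrix (m : 'I_n -> 'I_n -> option nat) : Prop :=
  [/\ forall i, m i i = Some 1%N,
      forall i j, m i j = m j i &
      forall i j k, i != j -> m i j = Some k -> (2 <= k)%N].

Definition coxeter_relations (m : 'I_n -> 'I_n -> option nat)
    (G : groupType) (f : 'I_n -> G) : Prop :=
  forall i j k, m i j = Some k -> ((f i * f j) ^+ k = 1)%g.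

(* The family [s] presents [W]: it generates [W] (the generators are
   involutions, so that no inverses are needed), satisfies the Coxeter
   relations, and is universal for them. *)
Definition coxeter_system (m : 'I_n -> 'I_n -> option nat)
    (W : groupType) (s : 'I_n -> W) : Prop :=
  [/\ coxeter_matrix m,
      forall g : W, exists a : seq 'I_n, (g = \prod_(i <- a) s i)%g,
      coxeter_relations m s &
      forall (G : groupType) (f : 'I_n -> G), coxeter_relations m f ->
        exists2 phi : W -> G,
          {morph phi : x y / (x * y)%g} & forall i, phi (s i) = f i].

Definition coxeter_element (W : groupType) (s : 'I_n -> W) (w : W) : Prop :=
  exists sigma : {perm 'I_n}, (w = \prod_(i < n) s (sigma i))%g.

Definition reflections (W : groupType) (s : 'I_n -> W) : set W :=
  [set r | exists g i, (r = s i ^ g)%g].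

End CoxeterSystems.

Definition inv_order (o : option nat) : rat :=
  if o is Some k then k%:R^-1 else 0.

Definition hyperbolic (m : 'I_3 -> 'I_3 -> option nat) : Prop :=
  \sum_(i < 3) \sum_(j < 3 | (i < j)%N) inv_order (m i j) < 1.

Section WordLength.
Variable W : groupType.

Definition factorization (T : set W) (u : W) (a : seq W) : Prop :=
  (forall x, x \in a -> T x) /\ (\prod_(x <- a) x = u)%g.

(* The least length of a factorization; the default value 0 is only used
   outside the subgroup generated by [T] if [T] is closed under inverses. *)
Definition word_length (T : set W) (u : W) : nat :=
  xget 0%N [set k | (exists2 a, factorization T u a & size a = k) /\
                    (forall a, factorization T u a -> (k <= size a)%N)].

Definition minimal_factorization (T : set W) (u : W) (a : seq W) : Prop :=
  factorization T u a /\ size a = word_length T u.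

Definition abs_le (T : set W) (u v : W) : Prop :=
  (word_length T u + word_length T (u^-1 * v)%g)%N = word_length T v.

Definition nc_interval (T : set W) (w : W) : set W := [set u | abs_le T u w].

Definition interval_reflections (T : set W) (w : W) : set W :=
  T `&` nc_interval T w.

Definition natural_label (u v : W) : W := (u^-1 * v)%g.

End WordLength.

Section ELLabelings.

Definition strict_total_order_on (L : Type) (A : set L) (lt : rel L) : Prop :=
  [/\ forall x, A x -> ~~ lt x x,
      forall x y z, A x -> A y -> A z -> lt x y -> lt y z -> lt x z &
      forall x y, A x -> A y -> x <> y -> lt x y || lt y x].

Fixpoint lex_lt (L : eqType) (lt : rel L) (a b : seq L) : bool :=
  match a, b with
  | x :: a', y :: b' => lt x y || (x == y) && lex_lt lt a' b'
  | [::], _ :: _ => true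
  | _, [::] => false
  end.

Variables (T L : eqType) (P : set T) (le : T -> T -> Prop).

Definition covers (x y : T) : Prop :=
  [/\ P x, P y, le x y, x <> y &
      forall z, P z -> le x z -> le z y -> z = x \/ z = y].

(* The chain [u :: c] is saturated, from [u] to [v]. *)
Definition saturated_chain (u v : T) (c : seq T) : Prop :=
  path (fun x y => `[< covers x y >]) u c /\ last u c = v.

Definition chain_word (lab : T -> T -> L) (u : T) (c : seq T) : seq L :=
  pairmap lab u c.

(* [lab x y] is only meaningful if [y] covers [x]; the labels range over the
   set [A], totally ordered by [lt]. *)
Definition EL_labeling (A : set L) (lt : rel L) (lab : T -> T -> L) : Prop :=
  (forall x y, covers x y -> A (lab x y)) /\
  forall u v, P u -> P v -> le u v ->
    exists c, [/\ saturated_chain u v c,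
      sorted lt (chain_word lab u c),
      forall c', saturated_chain u v c' ->
        sorted lt (chain_word lab u c') -> c' = c &
      forall c', saturated_chain u v c' -> c' <> c ->
        lex_lt lt (chain_word lab u c) (chain_word lab u c')].

End ELLabelings.

Section HyperbolicPlane.
Variable R : realType.
Notation E := 'cV[R]_3.

Definition lform (x y : E) : R :=
  x 0 0 * y 0 0 + x 1 0 * y 1 0 - x ord_max 0 * y ord_max 0.

Definition hplane : set E := [set x | lform x x = -1 /\ 0 < x ord_max 0].

Definition angle (o : option nat) : R :=
  if o is Some k then pi / k%:R else 0.

(* [nu i] is the outward unit normal of the [i]-th side, i.e. the triangle is
   the set of the [x] in [hplane] with [lform x (nu i) <= 0] for all [i]. Two
   sides with outward unit normals [a] and [b] that enclose the interior angle
   [t] satisfy [lform a b = - cos t]; they are asymptotic, i.e. meet in a point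
   at infinity, if [lform a b = -1]. *)
Definition hyperbolic_triangle (m : 'I_3 -> 'I_3 -> option nat)
    (nu : 'I_3 -> E) : Prop :=
  [/\ forall i, lform (nu i) (nu i) = 1,
      forall i j, i != j -> lform (nu i) (nu j) = - cos (angle (m i j)) &
      exists2 x, hplane x & forall i, lform x (nu i) < 0].

(* [rho] is the linear extension to R^3 of an action on the hyperbolic plane
   for which the generators act as the reflections in the sides of the
   triangle with outward unit normals [nu i]. *)
Definition reflection_action (W : groupType) (s : 'I_3 -> W) (nu : 'I_3 -> E)
    (rho : W -> 'M[R]_3) : Prop :=
  [/\ rho 1%g = 1%:M,
      forall g h, rho (g * h)%g = rho g *m rho h &
      forall i x, rho (s i) *m x = x - (2 * lform x (nu i)) *: nu i].

Definition cosh (t : R) : R := (expR t + expR (- t)) / 2.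
Definition sinh (t : R) : R := (expR t - expR (- t)) / 2.

(* An oriented line is given by one of its points [q] and the unit tangent
   vector [e] at [q] in the positive direction. *)
Definition pointed_line (q e : E) : Prop :=
  [/\ hplane q, lform e e = 1 & lform q e = 0].

Definition geodesic (q e : E) (t : R) : E := cosh t *: q + sinh t *: e.

Definition line (q e : E) : set E := range (geodesic q e).

Definition line_span (q e : E) : set E :=
  [set x | exists a b : R, x = a *: q + b *: e].

(* [A] is a glide reflection that translates the oriented line in the positive
   direction and interchanges the two sides of the line. *)
Definition glide_axis (A : 'M[R]_3) (q e : E) : Prop :=
  [/\ pointed_line q e,
      exists2 tau : R, 0 < tau &
        forall t, A *m geodesic q e t = geodesic q e (t + tau) &
      forall x, lform x q = 0 -> lform x e = 0 -> A *m x = - x].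

Definition fixed_space (A : 'M[R]_3) : set E := [set x | A *m x = x].

Definition fixed_line (A : 'M[R]_3) : set E := hplane `&` fixed_space A.

Section Chambers.
Variables (W : groupType) (T : set W) (rho : W -> 'M[R]_3).

Definition mirror_complement : set E :=
  hplane `\` \bigcup_(r in T) fixed_line (rho r).

Definition chamber (C : set E) : Prop :=
  exists2 x, mirror_complement x & C = connected_component mirror_complement x.

(* The interior is taken in [hplane]. *)
Definition axial_chamber (q e : E) (C : set E) : Prop :=
  chamber C /\ exists2 x, line q e x & C x /\ within hplane (nbhs x) C.

(* When t increases from 0 to pi, the line [ray q e t] traverses the
   projective line of [line_span q e], starting from the line spanned by [q]
   and going in the positive direction [e]. *)
Definition ray (q e : E) (t : R) : set E :=
  [set x | exists a : R, x = a *: (cos t *: q + sin t *: e)].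

Definition axially_before (q e : E) (r1 r2 : W) : Prop :=
  exists t1 t2 : R, [/\ 0 <= t1, t1 < t2, t2 < pi,
    fixed_space (rho r1) `&` line_span q e = ray q e t1 &
    fixed_space (rho r2) `&` line_span q e = ray q e t2].

Definition axial_ordering (w : W) (q e : E) (prec : rel W) : Prop :=
  strict_total_order_on (interval_reflections T w) prec /\
  forall r1 r2, interval_reflections T w r1 -> interval_reflections T w r2 ->
    axially_before q e r1 r2 -> prec r1 r2.

End Chambers.
End HyperbolicPlane.

(* Main.v *)
Require Import Defs.
From mathcomp Require Import all_boot all_order all_algebra all_fingroup.
From mathcomp Require Import all_classical all_reals all_analysis.
From mathcomp Require Import ring lra zify.

(* Realize reflections by roots, i.e. unit vectors up to sign, oriented such that
   [lform q b < 0]. If [w] is the product of the reflections along [b1], [b2]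
   and [b3], then
     - 2 * lform b1 b2 * det = sh * (1 + lform q b3 ^+ 2 - lform e b3 ^+ 2),
   where [sh] is the hyperbolic sine of the translation length and [det] is the
   determinant of the projections of [b1] and [b2] to the plane of the axis, in
   the basis [(e, q)].
   The right-hand side is nonnegative and vanishes only if [b1] and [b2] are
   orthogonal, so that the first reflection axially precedes the second iff
   [lform b1 b2 < 0]. Thus an increasing factorization is one whose positive
   roots are pairwise obtuse.
   For products of two reflections, uniqueness of an obtuse factorization and
   its lexicographic minimality follow from the fact that among the Gram
   determinants of three linearly independent roots that of the simple roots is
   the least in absolute value: a Coxeter element has the least translation
   length among the products of three reflections, as one sees by moving the
   axis of such a product to the base chamber and comparing with a Coxeter
   element below it in the Bruhat order. Hence a root has coefficients of
   absolute value 0 or at least 1 with respect to the roots of a factorization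
   of [w]. For [w] itself, the chamber of [q] has simple reflections of which
   [w] is a Coxeter element, and the inversions of [w] determine the first
   reflection of an obtuse factorization. *)

Set Implicit Arguments.
Unset Strict Implicit.
Unset Printing Implicit Defensive.

Import Order.TTheory GRing.Theory Num.Theory.
Local Open Scope classical_set_scope.
Local Open Scope ring_scope.

(** * The Lorentz form *)

Section LorentzForm.
Variable R : realType.
Notation E := 'cV[R]_3.
Implicit Types (x y z a b c : E) (k : R).
Notation B := (@lform R).

Lemma lformC x y : B x y = B y x.
Proof. by rewrite /lform; ring. Qed.

Lemma lformDl x y z : B (x + y) z = B x z + B y z.
Proof. by rewrite /lform !mxE; ring. Qed.

Lemma lformDr x y z : B z (x + y) = B z x + B z y.
Proof. by rewrite /lform !mxE; ring. Qed.

Lemma lformZl k x y : B (k *: x) y = k * B x y.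
Proof. by rewrite /lform !mxE; ring. Qed.

Lemma lformZr k x y : B x (k *: y) = k * B x y.
Proof. by rewrite /lform !mxE; ring. Qed.

Lemma lformNl x y : B (- x) y = - B x y.
Proof. by rewrite /lform !mxE; ring. Qed.

Lemma lformNr x y : B x (- y) = - B x y.
Proof. by rewrite /lform !mxE; ring. Qed.

Lemma lform0l x : B 0 x = 0.
Proof. by rewrite /lform !mxE; ring. Qed.

Lemma lform_suml (I : Type) (r : seq I) (P : pred I) (F : I -> E) x :
  B (\sum_(i <- r | P i) F i) x = \sum_(i <- r | P i) B (F i) x.
Proof.
exact: (big_morph (fun v => B v x) (fun u v => lformDl u v x) (lform0l x)).
Qed.

Definition lformE := (lformDl, lformDr, lformZl, lformZr, lformNl, lformNr).

Lemma vec3P x y :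
  x 0 0 = y 0 0 -> x 1 0 = y 1 0 -> x ord_max 0 = y ord_max 0 -> x = y.
Proof.
move=> h0 h1 h2; apply/matrixP => i j; rewrite (ord1 j).
case: i => [[|[|[|//]]] Hi].
- by rewrite (_ : Ordinal Hi = 0) //; apply/val_inj.
- by rewrite (_ : Ordinal Hi = 1) //; apply/val_inj.
- by rewrite (_ : Ordinal Hi = ord_max) //; apply/val_inj.
Qed.

Lemma lform_nondegenerate x : (forall y, B x y = 0) -> x = 0.
Proof.
move=> h; have := h (delta_mx 0 0); have := h (delta_mx 1 0).
have := h (delta_mx ord_max 0).
rewrite /lform !mxE /= => h2 h1 h0.
by apply: vec3P; rewrite !mxE; lra.
Qed.

(** Orthogonality eliminates the last coordinate of [v]: by Lagrange's identity, [q2 ^+ 2 * B v v]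
    is [- B q q] times [v0 ^+ 2 + v1 ^+ 2], plus a square. *)
Lemma lform_orth_timelike q v : B q q < 0 -> B q v = 0 ->
  0 <= B v v /\ (B v v = 0 -> v = 0).
Proof.
rewrite /lform.
set q0 := q 0 0; set q1 := q 1 0; set q2 := q ord_max 0.
set v0 := v 0 0; set v1 := v 1 0; set v2 := v ord_max 0 => hq hv.
have q2_gt0 : 0 < q2 * q2.
  by have := sqr_ge0 q0; have := sqr_ge0 q1; rewrite !expr2; lra.
have key : (q2 * q2) * (v0 * v0 + v1 * v1 - v2 * v2) =
  (q2 * q2 - q0 * q0 - q1 * q1) * (v0 * v0 + v1 * v1) +
  (q0 * v1 - q1 * v0) * (q0 * v1 - q1 * v0).
  have -> : (q2 * q2) * (v0 * v0 + v1 * v1 - v2 * v2) =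
    q2 * q2 * (v0 * v0 + v1 * v1) - (q2 * v2) * (q2 * v2) by ring.
  by rewrite (_ : q2 * v2 = q0 * v0 + q1 * v1); [ring | lra].
have hpos : 0 < q2 * q2 - q0 * q0 - q1 * q1 by lra.
have h1 : 0 <= v0 * v0 + v1 * v1.
  by rewrite addr_ge0 // -expr2 sqr_ge0.
have sq k : 0 <= k * k by rewrite -expr2 sqr_ge0.
split.
  by rewrite -(pmulr_rge0 _ q2_gt0) key addr_ge0 ?sq // mulr_ge0 // ltW.
move=> h; move: key; rewrite h mulr0 => key.
have s0 : v0 * v0 + v1 * v1 = 0.
  have := sq (q0 * v1 - q1 * v0); have := mulr_ge0 (ltW hpos) h1 => a1 a2.
  have /eqP : (q2 * q2 - q0 * q0 - q1 * q1) * (v0 * v0 + v1 * v1) = 0 by lra.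
  by rewrite mulf_eq0 (gt_eqF hpos) /= => /eqP.
have zero k : k * k = 0 -> k = 0 by move/eqP; rewrite mulf_eq0 orbb => /eqP.
have e0 : v0 = 0 by apply: zero; have := sq v0; have := sq v1; lra.
have e1 : v1 = 0 by apply: zero; have := sq v0; have := sq v1; lra.
have e2 : v2 = 0 by apply: zero; lra.
by apply: vec3P; rewrite mxE.
Qed.

Definition reflect_along b x : E := x - (2 * B x b) *: b.

Lemma reflect_alongK b x : B b b = 1 -> reflect_along b (reflect_along b x) = x.
Proof.
move=> hb; rewrite /reflect_along !lformE hb mulr1; apply/matrixP => i j.
by rewrite !mxE; ring.
Qed.

Lemma reflect_along_self b : B b b = 1 -> reflect_along b b = - b.
Proof.
by move=> hb; rewrite /reflect_along hb; apply/matrixP => i j; rewrite !mxE;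
  ring.
Qed.

Lemma reflect_along_isom b x y : B b b = 1 ->
  B (reflect_along b x) (reflect_along b y) = B x y.
Proof. by move=> hb; rewrite !lformE hb (lformC b y); ring. Qed.

(* The Gram determinant of three unit vectors, as a function of their pairwise
   products. *)
Definition gram (b1 b2 b3 : E) : R :=
  1 + 2 * B b1 b2 * B b1 b3 * B b2 b3
  - B b1 b2 ^+ 2 - B b1 b3 ^+ 2 - B b2 b3 ^+ 2.

Lemma gramCl b1 b2 b3 : gram b2 b1 b3 = gram b1 b2 b3.
Proof. by rewrite /gram (lformC b2 b1); ring. Qed.

Lemma gramCr b1 b2 b3 : gram b1 b3 b2 = gram b1 b2 b3.
Proof. by rewrite /gram (lformC b3 b2); ring. Qed.

(* The product of the reflections along [b1], [b2], [b3] has the eigenvalue -1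
   on the orthogonal complement of the kernel of this form. *)
Definition skew_form (b1 b2 b3 x : E) : R :=
  B x b1 * B b2 b3 - B x b2 * B b1 b3 + B x b3 * B b1 b2.

Lemma skew_formD b1 b2 b3 x y : skew_form b1 b2 b3 (x + y) =
  skew_form b1 b2 b3 x + skew_form b1 b2 b3 y.
Proof. by rewrite /skew_form !lformE; ring. Qed.

(* Four vectors of a space of dimension three have a singular Gram matrix. *)
Lemma gram_adjugate b1 b2 b3 x y : B b1 b1 = 1 -> B b2 b2 = 1 -> B b3 b3 = 1 ->
  gram b1 b2 b3 * B x y =
    B x b1 * B y b1 * (1 - B b2 b3 ^+ 2) + B x b2 * B y b2 * (1 - B b1 b3 ^+ 2)
  + B x b3 * B y b3 * (1 - B b1 b2 ^+ 2)
  + (B x b1 * B y b2 + B x b2 * B y b1) * (B b1 b3 * B b2 b3 - B b1 b2)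
  + (B x b1 * B y b3 + B x b3 * B y b1) * (B b1 b2 * B b2 b3 - B b1 b3)
  + (B x b2 * B y b3 + B x b3 * B y b2) * (B b1 b2 * B b1 b3 - B b2 b3).
Proof.
move=> h1 h2 h3.
have general : (B b1 b1 * B b2 b2 * B b3 b3 + 2 * B b1 b2 * B b1 b3 * B b2 b3
    - B b3 b3 * B b1 b2 ^+ 2 - B b2 b2 * B b1 b3 ^+ 2
    - B b1 b1 * B b2 b3 ^+ 2) * B x y =
    B x b1 * B y b1 * (B b2 b2 * B b3 b3 - B b2 b3 ^+ 2)
  + B x b2 * B y b2 * (B b1 b1 * B b3 b3 - B b1 b3 ^+ 2)
  + B x b3 * B y b3 * (B b1 b1 * B b2 b2 - B b1 b2 ^+ 2)
  + (B x b1 * B y b2 + B x b2 * B y b1) *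
      (B b1 b3 * B b2 b3 - B b3 b3 * B b1 b2)
  + (B x b1 * B y b3 + B x b3 * B y b1) *
      (B b1 b2 * B b2 b3 - B b2 b2 * B b1 b3)
  + (B x b2 * B y b3 + B x b3 * B y b2) *
      (B b1 b2 * B b1 b3 - B b1 b1 * B b2 b3).
  by rewrite /lform; ring.
by move: general; rewrite h1 h2 h3 /gram !mulr1 !mul1r.
Qed.

Section ThreeReflections.
Variables b1 b2 b3 : E.
Hypotheses (h1 : B b1 b1 = 1) (h2 : B b2 b2 = 1) (h3 : B b3 b3 = 1).

Let g x := reflect_along b1 (reflect_along b2 (reflect_along b3 x)).

(** On the axis of a glide reflection [g] the skew form vanishes, so that [1 - 2 * gram b1 b2 b3] is
    the hyperbolic cosine of the translation length; elsewhere the square only increases the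
    displacement. *)
Lemma lform_triple_reflection x :
  B x (g x) = (1 - 2 * gram b1 b2 b3) * B x x - 2 * skew_form b1 b2 b3 x ^+ 2.
Proof.
rewrite (_ : _ * B x x = B x x - 2 * (gram b1 b2 b3 * B x x)); last by ring.
rewrite gram_adjugate // /g /reflect_along /skew_form !lformE.
by rewrite (lformC b2 b1) (lformC b3 b1) (lformC b3 b2) ?h1 ?h2 ?h3; ring.
Qed.

Lemma skew_form_triple_reflection x :
  skew_form b1 b2 b3 (g x) = - skew_form b1 b2 b3 x.
Proof.
rewrite /g /reflect_along /skew_form !lformE.
rewrite (lformC b2 b1) (lformC b3 b1) (lformC b3 b2) ?h1 ?h2 ?h3; ring.
Qed.

Lemma gram_dual : gram b1 b2 b3 != 0 ->
  exists f, [/\ B f b1 = 1, B f b2 = 0 & B f b3 = 0].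
Proof.
(* The coefficients are the first row of the inverse of the Gram matrix. *)
move=> hd; exists ((gram b1 b2 b3)^-1 *: ((1 - B b2 b3 ^+ 2) *: b1 +
  (B b1 b3 * B b2 b3 - B b1 b2) *: b2 + (B b1 b2 * B b2 b3 - B b1 b3) *: b3)).
have e k : k = gram b1 b2 b3 -> (gram b1 b2 b3)^-1 * k = 1.
  by move=> ->; rewrite mulVf.
rewrite !lformE h1 h2 h3 (lformC b2 b1) (lformC b3 b1) (lformC b3 b2).
split.
- by apply: e; rewrite /gram; ring.
- by rewrite (_ : _ + _ = 0) ?mulr0 //; ring.
- by rewrite (_ : _ + _ = 0) ?mulr0 //; ring.
Qed.

Lemma gram_separates x : gram b1 b2 b3 != 0 ->
  B x b1 = 0 -> B x b2 = 0 -> B x b3 = 0 -> x = 0.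
Proof.
move=> hd e1 e2 e3; apply: lform_nondegenerate => y.
have := gram_adjugate x y h1 h2 h3; rewrite e1 e2 e3.
by rewrite !(mul0r, add0r) => /eqP; rewrite mulf_eq0 (negbTE hd) /= => /eqP.
Qed.

End ThreeReflections.

(** A fixed vector has the same image under the first reflection as under the product of the other
    two. Comparing coefficients of the independent [b1], [b2], [b3] shows that [x] is orthogonal to
    all of them. *)
Lemma triple_reflection_fixed b1 b2 b3 x :
  B b1 b1 = 1 -> B b2 b2 = 1 -> B b3 b3 = 1 -> gram b1 b2 b3 != 0 ->
  reflect_along b1 (reflect_along b2 (reflect_along b3 x)) = x -> x = 0.
Proof.
move=> h1 h2 h3 hd hx.
have := congr1 (reflect_along b1) hx; rewrite reflect_alongK //.
have [f1 [f11 f12 f13]] := gram_dual h1 h2 h3 hd.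
have hd3 : gram b3 b2 b1 != 0 by rewrite gramCl gramCr gramCl.
have hd2 : gram b2 b1 b3 != 0 by rewrite gramCl.
have [f3 [f33 f32 f31]] := gram_dual h3 h2 h1 hd3.
have [f2 [f22 f21 f23]] := gram_dual h2 h1 h3 hd2.
move=> e; have c1 := congr1 (B f1) e; have c2 := congr1 (B f2) e.
have c3 := congr1 (B f3) e; move: c1 c2 c3.
rewrite /reflect_along !lformE f11 f12 f13 f21 f22 f23 f31 f32 f33 => c1 c2 c3.
have e3 : B x b3 = 0 by lra.
have e1 : B x b1 = 0 by lra.
by apply: (gram_separates h1 h2 h3) => //; move: c2; rewrite e3 e1; lra.
Qed.

End LorentzForm.

(** * Mirrors in the plane of the axis *)

Section PolarCoordinates.
Variable R : realType.
Notation E := 'cV[R]_3.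
Notation B := (@lform R).

Lemma polar_coordinates (x y : R) : 0 < x ->
  exists t n : R, [/\ 0 <= t, t < pi, 0 < n, y = n * cos t & x = n * sin t].
Proof.
move=> x0; pose n := Num.sqrt (x ^+ 2 + y ^+ 2).
have n2_gt0 : 0 < x ^+ 2 + y ^+ 2.
  by rewrite ltr_pwDl ?exprn_gt0 ?sqr_ge0.
have n0 : 0 < n by rewrite sqrtr_gt0.
have nn : n ^+ 2 = x ^+ 2 + y ^+ 2 by rewrite sqr_sqrtr // ltW.
have ny : `|y| < n.
  rewrite -(ltr_pXn2r (_ : (0 < 2)%N)) ?nnegrE ?normr_ge0 ?(ltW n0) //.
  by rewrite nn real_normK ?num_real // ltrDr exprn_gt0.
have /andP [yn1 yn2] : -1 < y / n < 1.
  by rewrite ltr_pdivlMr // ltr_pdivrMr // mulN1r mul1r -ltr_norml.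
have yn : -1 <= y / n <= 1 by rewrite !ltW.
exists (acos (y / n)), n; split=> //.
- exact: acos_ge0.
- by apply: acos_ltpi; rewrite yn1 ltW.
- by rewrite acosK ?in_itv //= mulrC divfK ?gt_eqF.
rewrite sin_acos // (_ : 1 - _ = (x / n) ^+ 2).
  by rewrite sqrtr_sqr gtr0_norm ?divr_gt0 // mulrC divfK ?gt_eqF.
rewrite !expr_div_n nn; apply: (mulIf (_ : x ^+ 2 + y ^+ 2 != 0)).
  by rewrite gt_eqF.
by rewrite mulrBl !divfK ?gt_eqF //; ring.
Qed.

(** In the plane of the axis, the vectors orthogonal to [b] are the multiples of
    [- B b q *: e + B b e *: q]; its polar angle is the parameter of the ray, and [B q b < 0] places
    this angle in the upper half plane. *)
Lemma reflection_ray (A : 'M[R]_3) (q e b : E) :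
  (forall x, A *m x = reflect_along b x) -> B b b = 1 -> B q b < 0 ->
  exists t n : R, [/\ 0 <= t, t < pi, 0 < n,
    B b e = n * cos t /\ - B b q = n * sin t &
    fixed_space A `&` line_span q e = ray q e t].
Proof.
move=> hA bb qb; have x0 : 0 < - B b q by rewrite oppr_gt0 lformC.
have [t [n [t0 tpi n0 hc hs]]] := polar_coordinates (B b e) x0.
exists t, n; split=> //; have s0 : 0 < sin t.
  by rewrite -(pmulr_rgt0 _ n0) -hs.
apply/seteqP; split=> [x [hx [k [l ex]]]|x [k ex]].
  have xb : B x b = 0.
    move: hx; rewrite /fixed_space /= hA /reflect_along => /eqP.
    rewrite -subr_eq0 addrAC subrr add0r oppr_eq0 => /eqP h.
    have := congr1 (fun v => B v b) h; rewrite lformZl bb lform0l; lra.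
  exists (l / sin t); rewrite ex scalerDr !scalerA divfK ?gt_eqF //.
  congr (_ *: _ + _); apply: (mulIf (lt0r_neq0 s0)).
  rewrite mulrAC divfK ?gt_eqF //; apply: (mulfI (lt0r_neq0 n0)).
  move: xb; rewrite ex !lformE (lformC q) (lformC e) hc => xb.
  have := hs; have := xb; have -> : B b q = - (n * sin t) by lra.
  by move=> h _; lra.
split; last first.
  by exists (k * cos t), (k * sin t); rewrite ex scalerDr !scalerA.
rewrite /fixed_space /= hA /reflect_along
  (_ : B x b = 0) ?mulr0 ?scale0r ?subr0 //.
rewrite ex !lformE (lformC q) (lformC e) hc (_ : B b q = - (n * sin t));
  last lra.
ring.
Qed.

(** In polar coordinates the determinant is a positive multiple of [sin (t2 - t1)], whose sign
    compares the two angles. *)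
Lemma axially_before_det (W : groupType) (rho : W -> 'M[R]_3) (q e b1 b2 : E)
    (r1 r2 : W) :
  (forall x, rho r1 *m x = reflect_along b1 x) ->
  (forall x, rho r2 *m x = reflect_along b2 x) ->
  B b1 b1 = 1 -> B b2 b2 = 1 -> B q b1 < 0 -> B q b2 < 0 ->
  0 < B b1 q * B b2 e - B b1 e * B b2 q -> axially_before rho q e r1 r2.
Proof.
move=> h1 h2 u1 u2 q1 q2.
have [t1 [n1 [t10 t1pi n10 [c1 s1] f1]]] := reflection_ray e h1 u1 q1.
have [t2 [n2 [t20 t2pi n20 [c2 s2] f2]]] := reflection_ray e h2 u2 q2.
rewrite c1 c2 (_ : B b1 q = - (n1 * sin t1)) 1?(_ : B b2 q = - (n2 * sin t2));
  last 2 first.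
- lra.
- lra.
rewrite (_ : _ - _ = n1 * n2 * sin (t2 - t1)); last by rewrite sinB; ring.
rewrite pmulr_rgt0 ?mulr_gt0 // => hs; exists t1, t2; split=> //.
rewrite ltNge; apply/negP => t21; move: hs; rewrite ltNge => /negP; apply.
by rewrite -opprB sinN oppr_le0 sin_ge0_pi //; lra.
Qed.

End PolarCoordinates.

(** * Word lengths and chains of the interval *)

Section WordLengthTheory.
Variables (W : groupType) (T : set W).
Hypothesis generates : forall g : W, exists a, factorization T g a.
Local Notation len := (word_length T).
Implicit Types (g h u v : W) (a b : seq W).

Lemma word_lengthP g : (exists a, minimal_factorization T g a) /\
  forall a, factorization T g a -> (len g <= size a)%N.
Proof.
pose Q k := (exists2 a, factorization T g a & size a = k) /\
  (forall a, factorization T g a -> (k <= size a)%N).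
have [k Qk] : exists k, Q k.
  pose q k := `[< exists2 a, factorization T g a & size a = k >].
  have exq : exists k, q k.
    by have [a ha] := generates g; exists (size a); apply/asboolP; exists a.
  exists (ex_minn exq); case: ex_minnP => k /asboolP hk kmin; split=> // a ha.
  by apply: kmin; apply/asboolP; exists a.
have [[a ha ak] hmin] : Q (len g) by exact: (xgetI 0%N Qk).
by split=> //; exists a.
Qed.

Lemma minimal_factorization_exists g : exists a, minimal_factorization T g a.
Proof. by have [] := word_lengthP g. Qed.

Lemma word_length_le g a : factorization T g a -> (len g <= size a)%N.
Proof. by have [_] := word_lengthP g; apply. Qed.

Lemma factorization_cat g h a b :
  factorization T g a -> factorization T h b ->
    factorization T (g * h)%g (a ++ b).
Proof.
move=> [ha <-] [hb <-]; split; last by rewrite big_cat.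
by move=> x; rewrite mem_cat => /orP [/ha|/hb].
Qed.

Lemma factorization_cons t g a :
  T t -> factorization T g a -> factorization T (t * g)%g (t :: a).
Proof.
move=> ht [ha <-]; split; last by rewrite big_cons.
by move=> x; rewrite inE => /predU1P [->|/ha].
Qed.

Lemma factorization1 : factorization T 1%g [::].
Proof. by split=> //; rewrite big_nil. Qed.

Lemma word_lengthM g h : (len (g * h)%g <= len g + len h)%N.
Proof.
have [a [ha <-]] := minimal_factorization_exists g.
have [b [hb <-]] := minimal_factorization_exists h.
by rewrite -size_cat word_length_le //; exact: factorization_cat.
Qed.

Lemma word_length1 : len 1%g = 0%N.
Proof. by apply/eqP; rewrite -leqn0 (word_length_le factorization1). Qed.

Lemma word_length_eq0 g : len g = 0%N -> g = 1%g.
Proof.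
have [a [[_ <-] <-]] := minimal_factorization_exists g.
by move/size0nil ->; rewrite big_nil.
Qed.

Lemma word_length_letter t : T t -> (len t <= 1)%N.
Proof.
move=> ht; rewrite -(mulg1 t).
exact: (word_length_le (factorization_cons ht factorization1)).
Qed.

Lemma word_length_eq1 g : len g = 1%N -> T g.
Proof.
have [a [[ha <-] <-]] := minimal_factorization_exists g.
case: a ha => [|x [|//]] //= ha _; rewrite big_seq1.
by apply: ha; rewrite inE.
Qed.

Lemma minimal_factorization_cons t g a :
  minimal_factorization T g (t :: a) ->
  [/\ T t, minimal_factorization T (t^-1 * g)%g a & len g = (len
    (t^-1 * g)%g).+1].
Proof.
move=> [[ha hg] hs].
have ht : T t by apply: ha; rewrite mem_head.
have fa : factorization T (t^-1 * g)%g a.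
  split; first by move=> x xa; apply: ha; rewrite inE xa orbT.
  by rewrite -hg big_cons mulKg.
have l1 := word_length_le fa.
have l2 : (len g <= 1 + len (t^-1 * g)%g)%N.
  rewrite -{1}(mulKVg t g); apply: leq_trans (word_lengthM _ _) _.
  by rewrite leq_add2r word_length_letter.
have e : size a = len (t^-1 * g)%g.
  by apply/eqP; rewrite eqn_leq l1 andbT -ltnS (_ : (size a).+1 = len g).
by split=> //; rewrite -hs -e.
Qed.

Lemma word_lengthV : (forall t, T t -> T t^-1%g) ->
  forall g, len g^-1%g = len g.
Proof.
move=> TV; have le g : (len g^-1%g <= len g)%N.
  have [a [[ha hg] <-]] := minimal_factorization_exists g.
  rewrite -(size_map (fun x => x^-1%g) a) -(size_rev (map _ a)).
  apply: word_length_le; split.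
    by move=> x; rewrite mem_rev => /mapP [y ya ->]; exact: TV (ha _ ya).
  rewrite -hg; elim: a {ha hg} => [|x a IH]; first by rewrite !big_nil invg1.
  by rewrite /= rev_cons -cats1 big_cat big_seq1 IH big_cons invMg.
by move=> g; apply/eqP; rewrite eqn_leq le -{1}(invgK g) le.
Qed.

Lemma word_lengthJ : (forall t g, T t -> T (t ^ g)%g) ->
  forall g h, len (h ^ g)%g = len h.
Proof.
move=> TJ; have le g h : (len (h ^ g)%g <= len h)%N.
  have [a [[ha hg] <-]] := minimal_factorization_exists h.
  rewrite -(size_map (fun x => (x ^ g)%g) a).
  apply: word_length_le; split.
    by move=> x /mapP [y ya ->]; exact: TJ (ha _ ya).
  rewrite -hg; elim: a {ha hg} => [|x a IH]; first by rewrite !big_nil conj1g.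
  by rewrite /= !big_cons conjMg IH.
by move=> g h; apply/eqP; rewrite eqn_leq le -{1}(conjgK g h) le.
Qed.

Lemma word_length_parity (sg : W -> bool) :
  {morph sg : x y / (x * y)%g >-> x (+) y} -> (forall t, T t -> sg t = true) ->
  forall g, sg g = odd (len g).
Proof.
move=> sgM sgT g; have [a [[ha <-] <-]] := minimal_factorization_exists g.
elim: a ha => [|x a IH] ha.
  by rewrite big_nil /=; have := sgM 1%g 1%g; rewrite mulg1; case: (sg 1%g).
rewrite big_cons sgM sgT; last by apply: ha; rewrite mem_head.
by rewrite IH // => y ya; apply: ha; rewrite inE ya orbT.
Qed.

End WordLengthTheory.

(** * Saturated chains as minimal factorizations *)

Section ChainFactorizations.
Variables (W : groupType) (T : set W) (w : W).
Hypothesis generates : forall g : W, exists a, factorization T g a.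
Hypothesis TJ : forall t g, T t -> T (t ^ g)%g.
Local Notation len := (word_length T).
Local Notation P := (nc_interval T w).
Local Notation le := (abs_le T).

(** A conjugation, which preserves the length, moves [u] to the other side of [u^-1 * v]. This is
    what reduces the interval from [u] to [v] to the one from 1 to [u^-1 * v]. *)
Lemma nc_interval_quotient u v : P v -> le u v -> P (u^-1 * v)%g.
Proof.
rewrite /nc_interval /abs_le /= => hv huv.
apply/eqP; rewrite eqn_leq; apply/andP; split; last first.
  by rewrite -{1}(mulKVg (u^-1 * v)%g w) word_lengthM.
rewrite -hv -huv [X in (_ <= X + _)%N]addnC -addnA leq_add2l.
have -> : ((u^-1 * v)^-1 * w = u ^ (u^-1 * v) * (v^-1 * w))%g.
  by rewrite conjgE invMg invgK !mulgA !mulgK.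
by rewrite (leq_trans (word_lengthM generates _ _)) // word_lengthJ.
Qed.

Lemma nc_interval_down u v : P v -> le u v -> P u.
Proof.
rewrite /nc_interval /abs_le /= => hv huv.
apply/eqP; rewrite eqn_leq; apply/andP; split; last first.
  by rewrite -{1}(mulKVg u w) word_lengthM.
rewrite -hv -huv -addnA leq_add2l.
have -> : (u^-1 * w = (u^-1 * v) * (v^-1 * w))%g by rewrite -mulgA mulKVg.
exact: word_lengthM.
Qed.

Lemma abs_le_between u z v : le u v ->
  (len z <= len u + len (u^-1 * z)%g)%N ->
  (len (u^-1 * z)%g + len (z^-1 * v)%g <= len (u^-1 * v)%g)%N ->
  le u z /\ le z v.
Proof.
rewrite /abs_le => huv h1 h2.
have h3 : (len v <= len z + len (z^-1 * v)%g)%N.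
  by rewrite -{1}(mulKVg z v) word_lengthM.
have h4 : (len z <= len u + len (u^-1 * z)%g)%N.
  by rewrite -{1}(mulKVg u z) word_lengthM.
split; lia.
Qed.

(** If a minimal factorization of [u^-1 * v] had two letters or more, multiplying [u] by its first
    letter would give an element strictly in between. *)
Lemma covers_label u v : covers P le u v -> len (u^-1 * v)%g = 1%N.
Proof.
move=> [Pu Pv huv nuv hmid].
have [a ha] := minimal_factorization_exists generates (u^-1 * v)%g.
case: a ha => [|t [|t' a]] ha.
- case: ha => [[_]]; rewrite big_nil => /esym/(canRL (mulKg _)).
  by rewrite invgK mulg1 => e; case: nuv.
- by case: ha => _ <-.
have [Tt [f1 s1] l1] := minimal_factorization_cons generates ha.
have lt := word_length_letter generates Tt.
have [uz zv] : le u (u * t)%g /\ le (u * t)%g v.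
  apply: abs_le_between => //.
    by rewrite mulKg word_lengthM.
  by rewrite mulKg invMg -mulgA l1 -add1n leq_add2r.
have Pz := nc_interval_down Pv zv.
have [] := hmid _ Pz uz zv => e.
  have t1 : t = 1%g by apply: (@mulgI _ u); rewrite mulg1.
  by move: l1; rewrite t1 invg1 mul1g; lia.
move: s1 => /=; rewrite (_ : (t^-1 * (u^-1 * v) = 1)%g) ?word_length1 //.
by rewrite mulgA -invMg e mulVg.
Qed.

Lemma label_covers u v : P v -> le u v -> len (u^-1 * v)%g = 1%N ->
  covers P le u v.
Proof.
move=> Pv uv l1; split=> //; first exact: nc_interval_down uv.
  by move=> e; move: l1; rewrite e mulVg word_length1.
move=> z Pz uz zv.
have : len (u^-1 * z)%g = 0%N \/ len (z^-1 * v)%g = 0%N.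
  by move: uz zv uv; rewrite /abs_le; lia.
case=> /(word_length_eq0 generates)/(canRL (mulKg _));
  rewrite invgK mulg1 => ->; by [left | right].
Qed.

Lemma saturated_chain_factorization u v c : P u -> saturated_chain P le u v c ->
  minimal_factorization T (u^-1 * v)%g (chain_word (@natural_label W) u c).
Proof.
move=> Pu [hc <-] {v}.
suff [f e] : factorization T (u^-1 * last u c)%g
    (chain_word (@natural_label W) u c) /\ len (last u c) = (len u + size c)%N.
  split=> //; rewrite size_pairmap.
  apply/eqP; rewrite eqn_leq; apply/andP; split.
    rewrite -(leq_add2l (len u)) -e -{1}(mulKVg u (last u c)).
    exact: word_lengthM.
  by rewrite (leq_trans (word_length_le generates f)) // size_pairmap.
elim: c u Pu hc => [|x c IH] u Pu /=.
  by rewrite mulVg addn0 => _; split=> //; exact: factorization1.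
move=> /andP [/asboolP hux hc].
have l1 := covers_label hux; case: hux => _ Px ux _ _.
have [f e] := IH x Px hc.
have Tux := word_length_eq1 generates l1.
split; last by move: ux; rewrite /abs_le l1 /= e => <-; rewrite -addnA.
by have := factorization_cons Tux f; rewrite -mulgA mulKVg.
Qed.

Lemma factorization_saturated_chain u v a : P u -> P v -> le u v ->
  minimal_factorization T (u^-1 * v)%g a ->
  saturated_chain P le u v (scanl mulg u a).
Proof.
elim: a u => [|t a IH] u Pu Pv uv ha /=.
  case: ha => [[_]]; rewrite big_nil => /esym/(canRL (mulKg _)).
  by rewrite invgK mulg1 => ->.
have [Tt f1 l1] := minimal_factorization_cons generates ha.
have lt := word_length_letter generates Tt.
have [uz zv] : le u (u * t)%g /\ le (u * t)%g v.
  apply: abs_le_between => //.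
    by rewrite mulKg word_lengthM.
  by rewrite mulKg invMg -mulgA l1 -add1n leq_add2r.
have Pz := nc_interval_down Pv zv.
have [h1 h2] : saturated_chain P le (u * t)%g v (scanl mulg (u * t)%g a).
  by apply: IH => //; rewrite invMg -mulgA.
split=> //=; rewrite h1 andbT; apply/asboolP.
apply: label_covers => //; rewrite mulKg.
have := word_lengthM generates t (t^-1 * (u^-1 * v))%g.
by rewrite mulKVg l1; lia.
Qed.

(** Taking labels ([pairmap]) and taking partial products ([scanl]) are inverse bijections between
    the saturated chains from [u] to [v] and the minimal factorizations of [u^-1 * v]. *)
Lemma EL_labeling_of_factorizations (lt : rel W) :
  (forall u, P u -> exists a, [/\ minimal_factorization T u a,
      sorted lt a,
      forall b, minimal_factorization T u b -> sorted lt b -> b = a &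
      forall b, minimal_factorization T u b -> b <> a -> lex_lt lt a b]) ->
  EL_labeling P le (interval_reflections T w) lt (@natural_label W).
Proof.
move=> H; split.
  move=> x y hxy; have l1 := covers_label hxy; case: hxy => _ Py xy _ _.
  split; first exact: word_length_eq1 l1.
  exact: nc_interval_quotient.
move=> u v Pu Pv uv.
have chainK : cancel (pairmap (@natural_label W) u) (scanl mulg u).
  by apply: pairmapK => x y; exact: mulKVg.
have wordK : cancel (scanl mulg u) (pairmap (@natural_label W) u).
  by apply: scanlK => x y; exact: mulKg.
have [a [fa sa ua la]] := H _ (nc_interval_quotient Pv uv).
exists (scanl mulg u a); split.
- exact: factorization_saturated_chain.
- by rewrite /chain_word wordK.
- move=> c /(saturated_chain_factorization Pu) fc /(ua _ fc) <-.
  by rewrite chainK.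
- move=> c /(saturated_chain_factorization Pu) fc nc.
  rewrite {1}/chain_word wordK; apply: la => // e; apply: nc.
  by rewrite -e chainK.
Qed.

End ChainFactorizations.

(** * Positive and negative roots *)

(** A geometric representation with a point [x0] inside the base chamber. Universality is recorded
    only through the sign character; in this form the data pass to the simple reflections of any
    other chamber ([chamber_rep_conj]). *)
Record chamber_rep (R : realType) (m : 'I_3 -> 'I_3 -> option nat)
    (W : groupType) (s : 'I_3 -> W) (nu : 'I_3 -> 'cV[R]_3) (rho : W -> 'M[R]_3)
    (x0 : 'cV[R]_3) : Prop := ChamberRep {
  rep_matrix : coxeter_matrix m;
  rep_generated : forall g : W, exists a : seq 'I_3, (g = \prod_(i <- a) s i)%g;
  rep_relations : coxeter_relations m s;
  rep_sign : exists2 sg : W -> bool,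
    {morph sg : x y / (x * y)%g >-> x (+) y} & forall i, sg (s i) = true;
  rep_unit : forall i, lform (nu i) (nu i) = 1;
  rep_angle : forall i j, i != j ->
    lform (nu i) (nu j) = - cos (angle R (m i j));
  rep_inside : forall i, lform x0 (nu i) < 0;
  rep_action : reflection_action s nu rho }.

Section Representation.
Variables (R : realType) (m : 'I_3 -> 'I_3 -> option nat).
Variables (W : groupType) (s : 'I_3 -> W) (nu : 'I_3 -> 'cV[R]_3).
Variables (rho : W -> 'M[R]_3) (x0 : 'cV[R]_3).
Hypothesis H : chamber_rep m s nu rho x0.
Notation E := 'cV[R]_3.
Notation B := (@lform R).
Implicit Types (g h u v : W) (x y : E).

Lemma rho1 x : rho 1%g *m x = x.
Proof. by have [-> _ _] := rep_action H; rewrite mul1mx. Qed.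

Lemma rhoM g h x : rho (g * h)%g *m x = rho g *m (rho h *m x).
Proof. by have [_ -> _] := rep_action H; rewrite mulmxA. Qed.

Lemma rho_gen i x : rho (s i) *m x = reflect_along (nu i) x.
Proof. by have [_ _ ->] := rep_action H. Qed.

Lemma rhoK g x : rho g^-1%g *m (rho g *m x) = x.
Proof. by rewrite -rhoM mulVg rho1. Qed.

Lemma rhoKV g x : rho g *m (rho g^-1%g *m x) = x.
Proof. by rewrite -rhoM mulgV rho1. Qed.

Lemma rho_isom g x y : B (rho g *m x) (rho g *m y) = B x y.
Proof.
have [a ->] := rep_generated H g; elim: a => [|i a IH].
  by rewrite big_nil !rho1.
by rewrite big_cons !rhoM !rho_gen reflect_along_isom ?(rep_unit H).
Qed.

Lemma rho_isomV g x y : B (rho g^-1%g *m x) y = B x (rho g *m y).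
Proof. by rewrite -(rho_isom g) rhoKV. Qed.

Lemma gen_sq i : (s i * s i = 1)%g.
Proof.
have [h _ _] := rep_matrix H; have := rep_relations H (h i).
by rewrite expg1.
Qed.

Lemma gen_inv i : ((s i)^-1 = s i)%g.
Proof. by apply: (mulgI (s i)); rewrite mulgV gen_sq. Qed.

Notation S := (range s).
Notation len := (word_length S).

Lemma gen_factorization (a : seq 'I_3) :
  factorization S (\prod_(i <- a) s i)%g [seq s i | i <- a].
Proof. by split; [move=> x /mapP [i _ ->]; exists i | rewrite big_map]. Qed.

Lemma gen_generates g : exists a, factorization S g a.
Proof.
have [a ->] := rep_generated H g; exists [seq s i | i <- a].
exact: gen_factorization.
Qed.

Lemma reduced_word g : exists2 a : seq 'I_3,
  (g = \prod_(i <- a) s i)%g & size a = len g.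
Proof.
have [b [[hb <-] <-]] := minimal_factorization_exists gen_generates g.
elim: b hb => [|x b IH] hb; first by exists [::]; rewrite ?big_nil.
have [i _ ix] : S x by apply: hb; rewrite mem_head.
have [|a ha sa] := IH; first by move=> y yb; apply: hb; rewrite inE yb orbT.
by exists (i :: a); rewrite ?big_cons -?ha ?ix //= sa.
Qed.

Lemma len_word (a : seq 'I_3) : (len (\prod_(i <- a) s i)%g <= size a)%N.
Proof.
rewrite -(size_map s a).
exact: (word_length_le gen_generates (gen_factorization a)).
Qed.

Lemma len_gen i : (len (s i) <= 1)%N.
Proof. by apply: (word_length_letter gen_generates); exists i. Qed.

Lemma lenV g : len g^-1%g = len g.
Proof.
apply: (word_lengthV gen_generates) => _ [i _ <-].
by exists i; rewrite // gen_inv.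
Qed.

(** The sign character determines the parity of the length. *)
Lemma len_mul_gen_neq g i : len (g * s i)%g != len g.
Proof.
have [sg sgM sgs] := rep_sign H; apply/eqP => e.
have par := word_length_parity gen_generates sgM.
have sgS t : S t -> sg t = true by case=> j _ <-.
have := par sgS (g * s i)%g.
by rewrite sgM sgs e (par sgS) addbT; case: odd.
Qed.

Lemma exists_descent g : g <> 1%g -> exists j, (len (g * s j)%g < len g)%N.
Proof.
have [a ea sa] := reduced_word g; case/lastP: a ea sa => [|a j] -> sa.
  by rewrite big_nil.
move=> _; exists j; rewrite -sa size_rcons ltnS -cats1 big_cat big_seq1.
by rewrite -mulgA gen_sq mulg1 len_word.
Qed.

Fixpoint alternating (i j : 'I_3) (n : nat) : W :=
  if n is n'.+1 then (alternating j i n' * s j)%g else 1%g.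

Lemma alternatingD i j n k : alternating i j (n + k) =
  ((if odd k then alternating j i n else alternating i j n) * alternating i j
    k)%g.
Proof.
elim: k i j => [|k IH] i j; first by rewrite addn0 mulg1.
by rewrite addnS /= IH mulgA; case: odd.
Qed.

Lemma alternatingV i j n : ((alternating i j n)^-1 =
  if odd n then alternating i j n else alternating j i n)%g.
Proof.
elim: n i j => [|n IH] i j; first by rewrite invg1.
have cons a b : alternating a b n.+1 =
    ((if odd n then s a else s b) * alternating a b n)%g.
  by rewrite -[n.+1]add1n alternatingD /=; case: odd; rewrite mul1g.
rewrite [alternating i j n.+1]/= invMg gen_inv IH.
have fold a b : (alternating b a n * s b = alternating a b n.+1)%g by [].
by rewrite fold !cons /=; case: odd.
Qed.

Lemma alternating_double i j k : alternating i j k.*2 = ((s i * s j) ^+ k)%g.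
Proof. by elim: k => //= k IH; rewrite IH expgSr mulgA. Qed.

(** The Coxeter relation says that the alternating word of length [2 * k] is trivial, so its two
    halves are inverse to each other. *)
Lemma braid i j k : m i j = Some k -> alternating i j k = alternating j i k.
Proof.
move=> hk; have := rep_relations H hk.
rewrite -alternating_double -addnn alternatingD => /(canRL (mulKg _)).
by rewrite mulg1 => ->; case e: (odd k); rewrite alternatingV e.
Qed.

Lemma len_alternating i j n : (len (alternating i j n) <= n)%N.
Proof.
elim: n i j => [|n IH] i j /=; first by rewrite (word_length1 gen_generates).
rewrite (leq_trans (word_lengthM gen_generates _ _)) //.
by rewrite -[n.+1]addn1 leq_add ?len_gen.
Qed.

(* The ratio [sin (n t) / sin t], where [t] is the angle of the sides [i] and
   [j]; its limit [n] if [t = 0]. *)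
Definition sin_ratio i j (n : nat) : R :=
  if m i j is Some k then sin (n%:R * (pi / k%:R)) / sin (pi / k%:R) else n%:R.

Lemma sin_angle_gt0 k : (2 <= k)%N -> 0 < sin (pi / k%:R) :> R.
Proof.
move=> hk; have k0 : 0 < k%:R :> R by rewrite ltr0n (leq_trans _ hk).
apply: sin_gt0_pi; rewrite divr_gt0 ?pi_gt0 //=.
by rewrite ltr_pdivrMr // ltr_pMr ?pi_gt0 // ltr1n.
Qed.

Lemma sin_ratioS i j n : i != j -> sin_ratio i j n.+2 =
  2 * cos (angle R (m i j)) * sin_ratio i j n.+1 - sin_ratio i j n.
Proof.
rewrite /sin_ratio; case e: (m i j) => [k|] ij /=; last first.
  by rewrite cos0 -[n.+2]addn2 -[n.+1]addn1 !natrD; ring.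
set t := pi / _; rewrite (_ : n.+2%:R * t = n.+1%:R * t + t); last first.
  by rewrite -[n.+2]addn1 natrD; ring.
rewrite (_ : n%:R * t = n.+1%:R * t - t); last by rewrite -[n.+1]addn1 natrD;
  ring.
by rewrite sinD sinB; ring.
Qed.

Lemma sin_ratio0 i j : sin_ratio i j 0 = 0.
Proof. by rewrite /sin_ratio; case: (m i j) => [k|//];
  rewrite mul0r sin0 mul0r. Qed.

Lemma sin_ratio1 i j : i != j -> sin_ratio i j 1 = 1.
Proof.
move=> ij; rewrite /sin_ratio; case e: (m i j) => [k|//].
have [_ _ h] := rep_matrix H; rewrite mul1r divff // gt_eqF //.
exact: sin_angle_gt0 (h _ _ _ ij e).
Qed.

Lemma sin_ratio_ge0 i j n : i != j ->
  (forall k, m i j = Some k -> (n <= k)%N) -> 0 <= sin_ratio i j n.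
Proof.
rewrite /sin_ratio; case e: (m i j) => [k|//] ij h.
have [_ _ /(_ _ _ _ ij e) k2] := rep_matrix H.
have k0 : 0 < k%:R :> R by rewrite ltr0n (leq_trans _ k2).
rewrite divr_ge0 ?(ltW (sin_angle_gt0 k2)) // sin_ge0_pi //.
rewrite mulr_ge0 ?divr_ge0 ?pi_ge0 ?ler0n //= mulrA ler_pdivrMr //.
by rewrite mulrC ler_wpM2l ?pi_ge0 // ler_nat h.
Qed.

Lemma sin_ratioC i j n : sin_ratio j i n = sin_ratio i j n.
Proof. by have [_ h _] := rep_matrix H; rewrite /sin_ratio h. Qed.

Lemma alternating_act i j n : i != j -> rho (alternating i j n) *m nu i =
  sin_ratio i j (n + ~~ odd n) *: nu i + sin_ratio i j (n + odd n) *: nu j.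
Proof.
(* The recursion of [sin_ratio] has three terms, so the induction carries two consecutive values of
   [n]. *)
move=> ij; suff: (forall i j, i != j -> rho (alternating i j n) *m nu i =
    sin_ratio i j (n + ~~ odd n) *: nu i + sin_ratio i j (n + odd n) *: nu j) /\
  (forall i j, i != j -> rho (alternating i j n.+1) *m nu i =
    sin_ratio i j (n.+1 + ~~ odd n.+1) *: nu i +
    sin_ratio i j (n.+1 + odd n.+1) *: nu j).
  by case=> h _; apply: h.
elim: n {i j ij} => [|n [IH1 IH2]].
  split=> i j ij /=.
    by rewrite rho1 sin_ratio0 sin_ratio1 // scale1r scale0r addr0.
  rewrite mul1g rho_gen /reflect_along (rep_angle H) //.
  rewrite sin_ratioS // sin_ratio0 sin_ratio1 // scale1r -scaleNr.
  by congr (_ + _ *: _); ring.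
split=> // i j ij.
have -> : alternating i j n.+2 = (alternating j i n.+1 * s j)%g by [].
rewrite rhoM rho_gen /reflect_along mulmxBr -scalemxAr (rep_angle H) //.
rewrite [alternating j i n.+1]/= {1}rhoM rho_gen.
have -> : reflect_along (nu i) (nu i) = - nu i.
  by rewrite /reflect_along (rep_unit H) mulr1 scaler_nat mulr2n opprD addrA
    subrr sub0r.
rewrite mulmxN IH1 // (IH2 j i) 1?eq_sym // ![sin_ratio j i _]sin_ratioC.
have e1 : sin_ratio i j (n.+2 + ~~ odd n.+2) =
    2 * cos (angle R (m i j)) * sin_ratio i j (n.+1 + odd n.+1) -
    sin_ratio i j (n + ~~ odd n).
  by rewrite /= negbK; case: odd; rewrite /= ?addn0 ?addn1 sin_ratioS.
have e2 : sin_ratio i j (n.+2 + odd n.+2) =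
    2 * cos (angle R (m i j)) * sin_ratio i j (n.+1 + ~~ odd n.+1) -
    sin_ratio i j (n + odd n).
  by rewrite /= negbK; case: odd; rewrite /= ?addn0 ?addn1 sin_ratioS.
rewrite e1 e2; apply/matrixP => a b; rewrite !mxE; ring.
Qed.

(** Generators [s j], [s i], [s j], ... are removed on the right as long as the length drops. What
    remains, [v], is the shortest representative of the coset of [g] modulo the dihedral subgroup of
    [s i] and [s j]. *)
Lemma peel_alternating g i j : (len (g * s j)%g < len g)%N ->
  exists n v, [/\ g = (v * alternating i j n.+1)%g, len g = (len v + n.+1)%N,
    (len v < len (v * s i)%g)%N & (len v < len (v * s j)%g)%N].
Proof.
move: {2}(len g) (leqnn (len g)) => N; elim: N g i j => [|N IH] g i j.
  by rewrite leqn0 => /eqP ->.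
move=> hN hd.
have lg : len g = (len (g * s j)%g).+1.
  have := word_lengthM gen_generates (g * s j)%g (s j).
  by rewrite -mulgA gen_sq mulg1; have := len_gen j; lia.
have [h|h] := ltnP (len (g * s j * s i)%g) (len (g * s j)%g).
  have hN' : (len (g * s j)%g <= N)%N by move: hN; rewrite lg.
  have [n [v [e l h1 h2]]] := IH (g * s j)%g j i hN' h.
  exists n.+1, v; split; rewrite ?lg ?l ?addnS //.
  by rewrite -[alternating i j n.+2]/(alternating j i n.+1 * s j)%g mulgA -e
     -mulgA gen_sq mulg1.
exists 0%N, (g * s j)%g; rewrite /= mul1g -mulgA gen_sq mulg1 addn1; split=> //.
by rewrite ltn_neqAle h andbT eq_sym len_mul_gen_neq.
Qed.

Definition nonneg (x : E) : Prop :=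
  exists2 c : 'I_3 -> R, (forall i, 0 <= c i) & x = \sum_i c i *: nu i.

Lemma nonnegD x y : nonneg x -> nonneg y -> nonneg (x + y).
Proof.
move=> [c hc ->] [d hd ->]; exists (fun i => c i + d i).
  by move=> i; rewrite addr_ge0.
by rewrite -big_split; apply: eq_bigr => i _; rewrite scalerDl.
Qed.

Lemma nonnegZ k x : 0 <= k -> nonneg x -> nonneg (k *: x).
Proof.
move=> hk [c hc ->]; exists (fun i => k * c i).
  by move=> i; rewrite mulr_ge0.
by rewrite scaler_sumr; apply: eq_bigr => i _; rewrite scalerA.
Qed.

Lemma nonneg_nu i : nonneg (nu i).
Proof.
exists (fun j => (j == i)%:R); first by move=> j; rewrite ler0n.
rewrite (bigD1 i) //= eqxx scale1r big1 ?addr0 // => j /negbTE ->.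
by rewrite scale0r.
Qed.

Lemma nonneg_le p x : (forall i, B p (nu i) <= 0) -> nonneg x -> B p x <= 0.
Proof.
move=> hp [c hc ->]; rewrite lformC lform_suml sumr_le0 // => i _.
by rewrite lformZl lformC mulr_ge0_le0.
Qed.

Lemma nonneg_lt p x : (forall i, B p (nu i) < 0) -> nonneg x -> B x x = 1 ->
  B p x < 0.
Proof.
move=> hp [c hc ex] xx; rewrite ex lformC lform_suml.
have le i : B (c i *: nu i) p <= 0.
  by rewrite lformZl lformC mulr_ge0_le0 // ltW.
rewrite lt_neqAle sumr_le0 // andbT; apply/eqP => e0.
suff x0' : x = 0 by move: xx; rewrite x0' lform0l => /eqP;
  rewrite eq_sym oner_eq0.
rewrite ex big1 // => i _.
have : \sum_i - B (c i *: nu i) p = 0 by rewrite sumrN e0 oppr0.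
move/eqP; rewrite psumr_eq0 => [|j _]; last by rewrite oppr_ge0.
move/allP => /(_ i); rewrite mem_index_enum oppr_eq0 lformZl mulf_eq0 =>
  /(_ isT).
by rewrite lformC (lt_eqF (hp i)) orbF => /eqP ->; rewrite scale0r.
Qed.

(** For a descent [j] of [g], peel off an alternating word in [s i] and [s j]. It maps [nu i] to a
    nonnegative combination of [nu i] and [nu j], to which the induction hypothesis for the shorter
    [v] applies. *)
Lemma tits g i : (len g < len (g * s i)%g)%N -> nonneg (rho g *m nu i).
Proof.
move: {2}(len g) (leqnn (len g)) => N; elim: N g i => [|N IH] g i.
  rewrite leqn0 => /eqP /(word_length_eq0 gen_generates) -> _.
  by rewrite rho1; exact: nonneg_nu.
move=> hN hi; have [->|g1] := EM (g = 1%g).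
  by rewrite rho1; exact: nonneg_nu.
have [j hj] := exists_descent g1.
have ij : i != j by apply/eqP => e; move: hi hj; rewrite e; lia.
have [n [v [eg lg hvi hvj]]] := peel_alternating i hj.
(* Otherwise the braid relation would make the alternating word end in [s i], and [g * s i] would be
   shorter than [g]. The strict inequality matters: the coefficients involve [sin_ratio] up to
   [n.+2]. *)
have lt_order k : m i j = Some k -> (n.+1 < k)%N.
  move=> ek; rewrite ltnNge; apply/negP => kn.
  have [_ _ /(_ _ _ _ ij ek) k2] := rep_matrix H.
  pose h := if odd k then alternating j i (n.+1 - k) else alternating i j
    (n.+1 - k).
  have e1 : alternating i j n.+1 = (h * alternating j i k)%g.
    by rewrite -{1}(subnK kn) alternatingD (braid ek) /h; case: odd.
  have lh : (len h <= n.+1 - k)%N by rewrite /h; case: odd;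
    exact: len_alternating.
  case: k ek kn k2 @h e1 lh => [//|k] ek kn k2 h e1 lh.
  have e2 : (g * s i = v * (h * alternating i j k))%g.
    by rewrite eg e1 /= -!mulgA gen_sq mulg1.
  have l1 := word_lengthM gen_generates v (h * alternating i j k)%g.
  have l2 := word_lengthM gen_generates h (alternating i j k)%g.
  have l3 := len_alternating i j k.
  by move: hi; rewrite e2; lia.
rewrite eg rhoM alternating_act // mulmxDr -!scalemxAr.
apply: nonnegD; apply: nonnegZ.
- apply: sin_ratio_ge0 => // k /lt_order; case: odd => /=; lia.
- by apply: IH => //; lia.
- apply: sin_ratio_ge0 => // k /lt_order; case: odd => /=; lia.
- by apply: IH => //; lia.
Qed.

Lemma tits_neg g i : (len (g * s i)%g < len g)%N -> nonneg (- (rho g *m nu i)).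
Proof.
move=> h; have : nonneg (rho (g * s i)%g *m nu i).
  by apply: tits; rewrite -mulgA gen_sq mulg1.
rewrite rhoM rho_gen; congr nonneg.
rewrite /reflect_along (rep_unit H) mulr1 scaler_nat mulr2n opprD addrA subrr.
by rewrite sub0r mulmxN.
Qed.

Lemma root_dichotomy g i : nonneg (rho g *m nu i) \/ nonneg (- (rho g *m nu i)).
Proof.
have := len_mul_gen_neq g i; rewrite neq_ltn => /orP [/tits_neg|/tits];
  by [right|left].
Qed.

(** A nontrivial element has a descent, hence sends some simple root to a negative root. *)
Lemma rho_faithful g : (forall x, rho g *m x = x) -> g = 1%g.
Proof.
move=> h; have [//|g1] := EM (g = 1%g).
have [j /tits_neg] := exists_descent g1; rewrite h => hj.
have := nonneg_lt (rep_inside H) hj; rewrite !lformE (rep_unit H) opprK.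
by move/(_ erefl); rewrite oppr_lt0 => /(lt_trans (rep_inside H j));
  rewrite ltxx.
Qed.

End Representation.

(** * Roots of reflections, the Tits cone and the Bruhat order *)

Section Roots.
Variables (R : realType) (m : 'I_3 -> 'I_3 -> option nat).
Variables (W : groupType) (s : 'I_3 -> W) (nu : 'I_3 -> 'cV[R]_3).
Variables (rho : W -> 'M[R]_3) (x0 : 'cV[R]_3).
Hypothesis H : chamber_rep m s nu rho x0.
Hypothesis indep : gram (nu 0) (nu 1) (nu ord_max) != 0.
Notation E := 'cV[R]_3.
Notation B := (@lform R).
Notation len := (word_length (range s)).
Notation nonneg := (nonneg nu).
Implicit Types (g h r t u v w : W) (p x y z b : E).
Local Notation rhoM := (rhoM H).
Local Notation rhoK := (rhoK H).
Local Notation rhoKV := (rhoKV H).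
Local Notation rho1 := (rho1 H).

(** A relation, since each reflection has two opposite roots. *)
Definition root_of r b : Prop :=
  exists g i, r = (g * s i * g^-1)%g /\ b = rho g *m nu i.

Lemma root_unit r b : root_of r b -> B b b = 1.
Proof. by move=> [g [i [_ ->]]]; rewrite (rho_isom H) (rep_unit H). Qed.

Lemma root_act r b x : root_of r b -> rho r *m x = reflect_along b x.
Proof.
move=> [g [i [-> ->]]]; rewrite !rhoM (rho_gen H) /reflect_along.
by rewrite mulmxBr -scalemxAr rhoKV (rho_isomV H).
Qed.

Lemma root_conj g r b : root_of r b -> root_of (g * r * g^-1)%g (rho g *m b).
Proof.
move=> [h [i [-> ->]]]; exists (g * h)%g, i; rewrite rhoM; split=> //.
by rewrite invMg !mulgA.
Qed.

Lemma root_gen i : root_of (s i) (nu i).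
Proof. by exists 1%g, i; rewrite rho1 mul1g invg1 mulg1. Qed.

Lemma root_opp r b : root_of r b -> root_of r (- b).
Proof.
move=> [g [i [-> ->]]]; exists (g * s i)%g, i; split.
  by rewrite invMg (gen_inv H) !mulgA -(mulgA g (s i) (s i)) (gen_sq H) mulg1.
by rewrite rhoM (rho_gen H) reflect_along_self ?(rep_unit H) // mulmxN.
Qed.

Lemma root_sq r b : root_of r b -> (r * r = 1)%g.
Proof.
by move=> [g [i [-> _]]]; rewrite !mulgA mulgKV -(mulgA g (s i) (s i))
  (gen_sq H) mulg1 mulgV.
Qed.

Lemma root_inv r b : root_of r b -> (r^-1 = r)%g.
Proof. by move=> /root_sq e; apply: (mulgI r); rewrite mulgV. Qed.

Lemma root_reflect r b t c : root_of r b -> root_of t c ->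
  root_of (r * t * r)%g (reflect_along b c).
Proof.
by move=> hr ht; have := root_conj r ht; rewrite (root_inv hr) (root_act c hr).
Qed.

Lemma rho_inj g h : (forall x, rho g *m x = rho h *m x) -> g = h.
Proof.
move=> e; apply: (mulgI h^-1%g); rewrite mulVg.
by apply: (rho_faithful H) => x; rewrite rhoM e rhoK.
Qed.

Lemma root_inj r t b : root_of r b -> root_of t b -> r = t.
Proof.
by move=> hr ht; apply: rho_inj => x; rewrite (root_act x hr) (root_act x ht).
Qed.

Lemma reflectionsP r : reflections s r <-> exists b, root_of r b.
Proof.
split=> [[g [i ->]]|[_ [g [i [-> _]]]]].
  exists (rho g^-1%g *m nu i); exists g^-1%g, i; split=> //.
  by rewrite conjgE invgK mulgA.
by exists g^-1%g, i; rewrite conjgE invgK mulgA.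
Qed.

Lemma root_nonneg r b : root_of r b -> B x0 b < 0 -> nonneg b.
Proof.
move=> hb hn; have ub := root_unit hb; case: hb => g [i [_ eb]].
have := root_dichotomy H g i; rewrite -eb => -[//|/(nonneg_lt (rep_inside H))].
by rewrite !lformE opprK => /(_ ub); lra.
Qed.

Lemma root_pos_neg r b : root_of r b -> B x0 b < 0 \/ 0 < B x0 b.
Proof.
move=> hb; have ub := root_unit hb; case: hb => g [i [_ eb]].
have [] := root_dichotomy H g i; rewrite -eb => /(nonneg_lt (rep_inside H)).
  by move=> /(_ ub); left.
by rewrite !lformE opprK => /(_ ub) h; right; lra.
Qed.

Lemma gram_distinct i j k : i != j -> i != k -> j != k ->
  gram (nu i) (nu j) (nu k) = gram (nu 0) (nu 1) (nu ord_max).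
Proof.
have cases (l : 'I_3) : [\/ l = 0, l = 1 | l = ord_max].
  by case: l => [[|[|[|//]]] hl]; [constructor 1|constructor 2|constructor 3];
    exact/val_inj.
case: (cases i) => ->; case: (cases j) => ->; case: (cases k) => -> //.
- by rewrite gramCr.
- by rewrite gramCl.
- by rewrite gramCr gramCl.
- by rewrite gramCl gramCr.
- by rewrite gramCl gramCr gramCl.
Qed.

Lemma other_two (i : 'I_3) : exists j k, [/\ i != j, i != k & j != k].
Proof.
by case: i => [[|[|[|//]]] hi]; [exists 1, ord_max | exists 0, ord_max |
  exists 0, 1].
Qed.

Lemma other_two_cover (i j k l : 'I_3) : i != j -> i != k -> j != k ->
  [\/ l = i, l = j | l = k].
Proof.
case: i => [[|[|[|//]]] ?]; case: j => [[|[|[|//]]] ?] //;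
case: k => [[|[|[|//]]] ?] //; case: l => [[|[|[|//]]] ?] _ _ _;
  by [constructor 1; apply/val_inj | constructor 2; apply/val_inj |
      constructor 3; apply/val_inj].
Qed.

Lemma dual_vector i : exists f, forall j, B f (nu j) = (j == i)%:R.
Proof.
have [j [k [ij ik jk]]] := other_two i.
have hd : gram (nu i) (nu j) (nu k) != 0 by rewrite gram_distinct.
have [f [f1 f2 f3]] := gram_dual (rep_unit H i) (rep_unit H j)
  (rep_unit H k) hd.
exists f => l; have [->|->|->] := other_two_cover l ij ik jk.
- by rewrite eqxx f1.
- by rewrite eq_sym (negbTE ij) f2.
- by rewrite eq_sym (negbTE ik) f3.
Qed.

Lemma dual_sum f i (c : 'I_3 -> R) : (forall j, B f (nu j) = (j == i)%:R) ->
  B f (\sum_j c j *: nu j) = c i.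
Proof.
move=> hf; rewrite lformC lform_suml (bigD1 i) //= lformZl lformC hf eqxx mulr1.
rewrite big1 ?addr0 // => j /negbTE ji.
by rewrite lformZl lformC hf ji mulr0.
Qed.

Lemma nonneg_dual f i x : (forall j, B f (nu j) = (j == i)%:R) -> nonneg x ->
  0 <= B f x.
Proof. by move=> hf [c hc ->]; rewrite (dual_sum _ hf). Qed.

(** The reflection along [nu i] only alters the coefficient of [nu i]. If it made [b] negative, all
    other coefficients of [b] would vanish, and the unit vector [b] would be [nu i]. *)
Lemma gen_permutes_pos i r b : root_of r b -> B x0 b < 0 -> b <> nu i ->
  B x0 (reflect_along (nu i) b) < 0.
Proof.
move=> hb pb nb; have hb' := root_reflect (root_gen i) hb.
have [//|nb'] := root_pos_neg hb'; case: nb.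
have n1 := root_nonneg hb pb.
have n2 : nonneg (- reflect_along (nu i) b).
  by apply: (root_nonneg (root_opp hb')); rewrite lformNr; lra.
case: n1 => c c0 eb.
have c_eq0 j : j != i -> c j = 0.
  move=> ji; have [f hf] := dual_vector j.
  have := nonneg_dual hf n2;
    rewrite /reflect_along !lformE hf eq_sym (negbTE ji).
  rewrite mulr0 subr0 eb (dual_sum _ hf); have := c0 j; lra.
have e1 : b = c i *: nu i.
  rewrite eb (bigD1 i) //= big1 ?addr0 // => j /c_eq0 ->; exact: scale0r.
have := root_unit hb; rewrite e1 !lformE (rep_unit H) mulr1 -expr2 => /eqP.
rewrite sqrf_eq1 => /orP [] /eqP e2; first by rewrite e2 scale1r.
by have := c0 i; rewrite e2 oppr_ge0 ler10.
Qed.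

(** An inversion of [s i * g] other than [nu i] is the image under [s i] of an inversion of [g]. *)
Lemma inversions_finite g : exists L : seq E, forall r b, root_of r b ->
  B x0 b < 0 -> 0 < B x0 (rho g^-1%g *m b) -> b \in L.
Proof.
have [a ->] := rep_generated H g; elim: a => [|i a [L hL]].
  by exists [::] => r b _; rewrite big_nil invg1 rho1; lra.
exists (nu i :: [seq reflect_along (nu i) b | b <- L]) => r b hb pb.
rewrite big_cons invMg (gen_inv H) rhoM (rho_gen H) => nb.
have [->|bi] := eqVneq b (nu i); first by rewrite mem_head.
rewrite inE; apply/orP; right; apply/mapP.
exists (reflect_along (nu i) b); last by rewrite reflect_alongK ?(rep_unit H).
apply: hL nb; first exact: root_reflect (root_gen i) hb.
by apply: gen_permutes_pos hb pb _; exact/eqP.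
Qed.

Lemma len_gen_mul i g : (len g < len (s i * g)%g)%N ->
  B x0 (rho g^-1%g *m nu i) < 0.
Proof.
move=> h; apply: (nonneg_lt (rep_inside H)); last first.
  by rewrite (rho_isom H) (rep_unit H).
apply: (tits H); rewrite -(lenV H) -(lenV H (g^-1 * s i)%g).
by rewrite invMg !invgK (gen_inv H).
Qed.

Definition closed_chamber x : Prop := forall i, B x (nu i) <= 0.

Definition tits_cone x : Prop :=
  exists g y, closed_chamber y /\ x = rho g *m y.

Lemma tits_cone_act g x : tits_cone x -> tits_cone (rho g *m x).
Proof. by move=> [h [y [hy ->]]]; exists (g * h)%g, y; rewrite rhoM. Qed.

Lemma closed_chamberZ k x : 0 <= k -> closed_chamber x ->
  closed_chamber (k *: x).
Proof. by move=> hk hx i; rewrite lformZl mulr_ge0_le0. Qed.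

Lemma tits_coneZ k x : 0 <= k -> tits_cone x -> tits_cone (k *: x).
Proof.
move=> hk [g [y [hy ->]]]; exists g, (k *: y); rewrite -scalemxAr; split=> //.
exact: closed_chamberZ.
Qed.

(* The segment from [y] to [g z] leaves the closed chamber through a wall; the
   reflection in this wall shortens [g]. *)
Lemma tits_cone_segment g y z : closed_chamber y -> closed_chamber z ->
  tits_cone (y + rho g *m z).
Proof.
move: {2}(len g) (leqnn (len g)) => N; elim: N g y z => [|N IH] g y z.
  rewrite leqn0 => /eqP /(word_length_eq0 (gen_generates H)) -> hy hz.
  exists 1%g, (y + z); rewrite !rho1; split=> // i.
  by rewrite lformDl; have := hy i; have := hz i; lra.
move=> hg hy hz; set p := _ + _.
have [hp|] := pselect (closed_chamber p).
  by exists 1%g, p; rewrite rho1.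
move=> /existsNP [j0 /negP]; rewrite -ltNge => hj0.
pose d j := B (rho g *m z) (nu j).
pose t j := - B y (nu j) / d j.
have dj0 : 0 < d j0.
  by move: hj0; rewrite /p lformDl /d; have := hy j0; lra.
case: (@Order.TotalTheory.arg_minP _ _ _ j0 (fun j => 0 < d j) t dj0) =>
  j dj tmin.
have t0 : 0 <= t j by rewrite divr_ge0 ?oppr_ge0 ?hy // ltW.
have t1 : t j < 1.
  apply: le_lt_trans (tmin _ dj0) _; rewrite ltr_pdivrMr // mul1r.
  by move: hj0; rewrite /p lformDl -/(d j0); lra.
pose y' := y + t j *: (rho g *m z).
have y'j : B y' (nu j) = 0.
  rewrite /y' lformDl lformZl -/(d j) /t divfK ?subrr ?gt_eqF //; lra.
have hy' : closed_chamber y'.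
  move=> i; rewrite /y' lformDl lformZl -/(d i).
  have [di|di] := leP (d i) 0.
    by have := hy i; have := mulr_ge0_le0 t0 di; lra.
  have := tmin i di; rewrite {2}/t ler_pdivlMr //; lra.
have lg : (len (s j * g)%g < len g)%N.
  rewrite ltn_neqAle; apply/andP; split.
    have := len_mul_gen_neq H g^-1%g j; rewrite (lenV H) -(lenV H (s j * g)%g).
    by rewrite invMg (gen_inv H).
  rewrite leqNgt; apply/negP => /len_gen_mul hh.
  have := root_nonneg (root_conj g^-1%g (root_gen j)) hh.
  move/(nonneg_le hz); rewrite lformC (rho_isomV H) lformC.
  by rewrite -/(d j); lra.
have : tits_cone (y' + rho (s j * g)%g *m ((1 - t j) *: z)).
  apply: IH => //; first by rewrite -ltnS; apply: leq_trans lg hg.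
  by apply: closed_chamberZ => //; lra.
move/(tits_cone_act (s j)); congr tits_cone.
rewrite mulmxDr -rhoM mulgA (gen_sq H) mul1g (rho_gen H) /reflect_along y'j.
rewrite mulr0 scale0r subr0 /y' -scalemxAr /p -addrA -scalerDl addrC.
by rewrite (_ : t j + _ = 1) ?scale1r 1?addrC //; ring.
Qed.

Lemma tits_coneD x p : tits_cone x -> tits_cone p -> tits_cone (x + p).
Proof.
move=> [g [y [hy ->]]] [h [z [hz ->]]].
rewrite (_ : _ + _ = rho g *m (y + rho (g^-1 * h)%g *m z)).
  by apply: tits_cone_act; exact: tits_cone_segment.
by rewrite mulmxDr -rhoM mulKVg.
Qed.

(** The Bruhat order. That [t * y] lies above [y] is expressed by the signs of [b] and of its image
    under the inverse of [y] instead of by lengths; these signs are what the comparison of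
    displacements uses. *)
Inductive bruhat (z : W) : W -> Prop :=
| bruhat_refl : bruhat z z
| bruhat_step (y : W) t b : bruhat z y -> root_of t b -> B x0 b < 0 ->
    B x0 (rho y^-1%g *m b) < 0 -> bruhat z (t * y)%g.

(** The lifting property, by induction along the chain. A step by [s i] itself exchanges the two
    cases; any other step is conjugated by [s i], which keeps its root positive. *)
Lemma bruhat_lift i (z y : W) : bruhat z y -> B x0 (rho z^-1%g *m nu i) < 0 ->
  (B x0 (rho y^-1%g *m nu i) < 0 -> bruhat (s i * z)%g (s i * y)%g) /\
  (0 < B x0 (rho y^-1%g *m nu i) -> bruhat (s i * z)%g y).
Proof.
move=> hzy hz; elim: hzy => [|y' t b hy' [IH1 IH2] ht pb pyb].
  by split=> [_|]; [exact: bruhat_refl | lra].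
have key k : B x0 (rho (s i * k)^-1%g *m nu i) = - B x0 (rho k^-1%g *m nu i).
  rewrite invMg (gen_inv H) rhoM (rho_gen H) reflect_along_self
    ?(rep_unit H) //.
  by rewrite mulmxN lformNr.
have [hy|hy] := root_pos_neg (root_conj y'^-1%g (root_gen i)); last first.
  have h : bruhat (s i * z)%g (t * y')%g by apply: bruhat_step ht pb pyb;
    exact: IH2.
  split=> // hty; apply: bruhat_step h (root_gen i) _ hty.
  exact: rep_inside H i.
have [ebi|nbi] := eqVneq b (nu i).
  have et : t = s i by apply: root_inj ht _; rewrite ebi; exact: root_gen.
  rewrite et key; split; first lra.
  by move=> _; exact: IH1.
have h : bruhat (s i * z)%g (s i * (t * y'))%g.
  have -> : (s i * (t * y') = (s i * t * s i) * (s i * y'))%g.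
    by rewrite -!mulgA (mulgA (s i) (s i)) (gen_sq H) mul1g.
  apply: bruhat_step (IH1 hy) (root_reflect (root_gen i) ht) _ _.
    by apply: gen_permutes_pos ht pb _; exact/eqP.
  by rewrite invMg (gen_inv H) rhoM (rho_gen H) reflect_alongK ?(rep_unit H).
split=> // hty.
have -> : (t * y' = s i * (s i * (t * y')))%g by rewrite mulgA (gen_sq H) mul1g.
apply: bruhat_step h (root_gen i) (rep_inside H i) _.
by rewrite key; lra.
Qed.

(** Each step subtracts [2 * B (rho y *m p) b * B p b], and both products are nonpositive because
    [b] and its image under the inverse of [y] are positive roots. *)
Lemma bruhat_displacement (z y : W) p : closed_chamber p -> bruhat z y ->
  B p (rho y *m p) <= B p (rho z *m p).
Proof.
move=> hp; elim=> [//|y' t b _ IH ht pb pyb]; apply: le_trans IH.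
rewrite rhoM (root_act _ ht) /reflect_along !lformE.
have h1 := nonneg_le hp (root_nonneg ht pb).
have h2 : B (rho y' *m p) b <= 0.
  rewrite -(rho_isom H y'^-1%g) rhoK.
  exact: nonneg_le hp (root_nonneg (root_conj y'^-1%g ht) pyb).
have := mulr_le0 h2 h1; lra.
Qed.

Lemma bruhat_displacement_lt (z y : W) p : (forall i, B p (nu i) < 0) ->
  bruhat z y -> y = z \/ B p (rho y *m p) < B p (rho z *m p).
Proof.
move=> hp; elim=> [|y' t b hy' _ ht pb pyb]; [by left | right].
apply: lt_le_trans (bruhat_displacement (fun i => ltW (hp i)) hy').
rewrite rhoM (root_act _ ht) /reflect_along !lformE.
have h1 := nonneg_lt hp (root_nonneg ht pb) (root_unit ht).
have ht' := root_conj y'^-1%g ht.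
have h2 : B (rho y' *m p) b < 0.
  rewrite -(rho_isom H y'^-1%g) rhoK.
  exact: nonneg_lt hp (root_nonneg ht' pyb) (root_unit ht').
by have : 0 < B (rho y' *m p) b * B p b by [rewrite nmulr_rgt0]; lra.
Qed.

Lemma word_fixes_dual f i (a : seq 'I_3) :
  (forall j, B f (nu j) = (j == i)%:R) -> i \notin a ->
  rho (\prod_(j <- a) s j)%g *m f = f.
Proof.
move=> hf; elim: a => [|j a IH]; first by rewrite big_nil rho1.
rewrite inE negb_or => /andP [ij /IH e]; rewrite big_cons rhoM e (rho_gen H).
by rewrite /reflect_along hf eq_sym (negbTE ij) mulr0 scale0r subr0.
Qed.

(** Words without the letter [i] fix the dual vector of [nu i], so the image of [nu i] still has the
    coefficient 1 at [nu i]. *)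
Lemma word_avoiding_root_pos i (a : seq 'I_3) : i \notin a ->
  B x0 (rho (\prod_(j <- a) s j)^-1%g *m nu i) < 0.
Proof.
move=> ia; have hr := root_conj (\prod_(j <- a) s j)^-1%g (root_gen i).
have [//|h] := root_pos_neg hr; have [f hf] := dual_vector i.
have : nonneg (- (rho (\prod_(j <- a) s j)^-1%g *m nu i)).
  by apply: root_nonneg (root_opp hr) _; rewrite lformNr; lra.
move/(nonneg_dual hf); rewrite lformNr lformC (rho_isomV H).
by rewrite (word_fixes_dual hf ia) lformC hf eqxx oppr_ge0 ler10.
Qed.

(** The letters of [b] being distinct, its tail avoids its head; this gives the positivity that the
    lifting property requires when a letter is kept. *)
Lemma bruhat_subword (a b : seq 'I_3) : subseq b a -> uniq b ->
  len (\prod_(j <- a) s j)%g = size a ->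
  bruhat (\prod_(j <- b) s j)%g (\prod_(j <- a) s j)%g.
Proof.
elim: a b => [|i a IH] b; first by rewrite subseq0 => /eqP ->; constructor.
move=> hb ub; rewrite big_cons /= => la.
have la' : len (\prod_(j <- a) s j)%g = size a.
  have l1 := len_word H a; have l2 := len_gen H i.
  apply/eqP; rewrite eqn_leq l1 /= -ltnS -la.
  apply: leq_trans (word_lengthM (gen_generates H) _ _) _.
  exact: (leq_add l2 (leqnn _)).
have pos : B x0 (rho (\prod_(j <- a) s j)^-1%g *m nu i) < 0.
  by apply: len_gen_mul; rewrite la la'.
have up c : bruhat c (\prod_(j <- a) s j)%g ->
    bruhat c (s i * \prod_(j <- a) s j)%g.
  by move=> h; apply: bruhat_step h (root_gen i) (rep_inside H i) pos.
case: b hb ub => [|j b] /=.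
  by move=> _ _; apply/up/(IH [::]); rewrite ?sub0seq.
have [->|ij] := eqVneq j i; last by move=> hb ub; apply/up/(IH (j :: b)).
move=> hb /andP [ib ub]; rewrite big_cons.
have [h _] := bruhat_lift (IH b hb ub la') (word_avoiding_root_pos ib).
exact: h.
Qed.

End Roots.

(** * Minimality of the translation length of a Coxeter element *)

Section Minimality.
Variables (R : realType) (m : 'I_3 -> 'I_3 -> option nat).
Variables (W : groupType) (s : 'I_3 -> W) (nu : 'I_3 -> 'cV[R]_3).
Variables (rho : W -> 'M[R]_3) (x0 : 'cV[R]_3).
Hypothesis H : chamber_rep m s nu rho x0.
Hypothesis x0_timelike : lform x0 x0 < 0.
Hypothesis indep : gram (nu 0) (nu 1) (nu ord_max) != 0.
Notation E := 'cV[R]_3.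
Notation B := (@lform R).
Notation root_of := (root_of s nu rho).
Notation bruhat := (bruhat s nu rho x0).
Notation gram0 := (gram (nu 0) (nu 1) (nu ord_max)).
Implicit Types (g h r t u v w : W) (p x y z b : E).
Local Notation rhoM := (rhoM H).
Local Notation rhoK := (rhoK H).
Local Notation rhoKV := (rhoKV H).
Local Notation rho1 := (rho1 H).

Lemma root_act3 t1 b1 t2 b2 t3 b3 x :
  root_of t1 b1 -> root_of t2 b2 -> root_of t3 b3 ->
  rho (t1 * t2 * t3)%g *m x =
  reflect_along b1 (reflect_along b2 (reflect_along b3 x)).
Proof.
by move=> h1 h2 h3; rewrite !rhoM (root_act H _ h3) (root_act H _ h2)
  (root_act H _ h1).
Qed.

(** A reduced word of [g] contains every generator, as otherwise [g] would fix a dual vector.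
    Keeping one occurrence of each generator leaves a Coxeter element. *)
Lemma exists_coxeter_subword g : (forall x, rho g *m x = x -> x = 0) ->
  exists i j k, [/\ i != j, i != k, j != k & bruhat (s i * s j * s k)%g g].
Proof.
move=> hg; have [a ga sa] := reduced_word H g.
have all_a i : i \in undup a.
  rewrite mem_undup; apply: contraT => ia; have [f hf] := dual_vector H indep i.
  have := hf i; rewrite (hg f) ?lform0l ?eqxx.
    by move/eqP; rewrite eq_sym oner_eq0.
  by rewrite ga (word_fixes_dual H hf).
have /perm_size : perm_eq (undup a) (enum 'I_3).
  by apply: uniq_perm; rewrite ?undup_uniq ?enum_uniq // => i;
    rewrite all_a mem_enum.
rewrite size_enum_ord.
have ub := undup_uniq a; have hb := undup_subseq a.
have := bruhat_subword H indep hb ub; rewrite -ga -sa => /(_ erefl).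
case: (undup a) ub => [|i [|j [|k [|//]]]] //= /and3P [].
rewrite !inE negb_or => /andP [ij ik] jk _.
rewrite !big_cons big_nil mulg1 mulgA => hb' _.
by exists i, j, k.
Qed.

Lemma coxeter_displacement i j k p : i != j -> i != k -> j != k ->
  B p (rho (s i * s j * s k)%g *m p) <= (1 - 2 * gram0) * B p p.
Proof.
move=> ij ik jk; rewrite (root_act3 _ (root_gen H i) (root_gen H j)
  (root_gen H k)).
rewrite lform_triple_reflection ?(rep_unit H) // (gram_distinct _ ij ik jk).
by have := sqr_ge0 (skew_form (nu i) (nu j) (nu k) p); lra.
Qed.

Lemma bruhat1 g : bruhat 1%g g.
Proof.
have [a ga sa] := reduced_word H g.
have := bruhat_subword H indep (sub0seq a) (isT : uniq [::]).
by rewrite -ga -sa big_nil; apply.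
Qed.

(* The midpoint of [x0] and [g x0] lies on the axis of the glide reflection
   [g]. Move it to the base chamber and compare with a Coxeter element below
   the conjugate of [g]. *)
Lemma gram_roots_le t1 b1 t2 b2 t3 b3 :
  root_of t1 b1 -> root_of t2 b2 -> root_of t3 b3 ->
  gram b1 b2 b3 != 0 -> gram b1 b2 b3 <= gram0.
Proof.
move=> h1 h2 h3 hd; set g := (t1 * t2 * t3)%g.
have [u1 u2 u3] := And3 (root_unit H h1) (root_unit H h2) (root_unit H h3).
have ins : closed_chamber nu x0 by move=> i; apply/ltW/(rep_inside H).
pose p : E := x0 + rho g *m x0.
(* The identity lies below [g] in the Bruhat order, so that [B x0 (rho g *m x0) <= B x0 x0]. *)
have pp : B p p < 0.
  rewrite /p !lformE (rho_isom H) (lformC (rho g *m x0) x0).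
  by have := bruhat_displacement H ins (bruhat1 g); rewrite rho1;
    move: x0_timelike; lra.
(* The skew form changes sign under [g], hence vanishes at [p]. *)
have gp : B p (rho g *m p) = (1 - 2 * gram b1 b2 b3) * B p p.
  rewrite /g (root_act3 _ h1 h2 h3) lform_triple_reflection //.
  rewrite {3}/p skew_formD (root_act3 _ h1 h2 h3) skew_form_triple_reflection
    //.
  by rewrite subrr expr0n mulr0 subr0.
have [h [p0 [hp0 ep]]] : tits_cone nu rho p :=
  tits_cone_segment H g ins ins.
pose g' := (h^-1 * g * h)%g.
have [i [j [k [ij ik jk hb]]]] : exists i j k,
    [/\ i != j, i != k, j != k & bruhat (s i * s j * s k)%g g'].
  apply: exists_coxeter_subword => x hx.
  have : rho g *m (rho h *m x) = rho h *m x.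
    by rewrite -{2}hx /g' !rhoM rhoKV.
  rewrite /g (root_act3 _ h1 h2 h3) => /triple_reflection_fixed hz.
  by rewrite -(rhoK h x) hz // mulmx0.
have l1 := bruhat_displacement H hp0 hb.
have l2 := coxeter_displacement p0 ij ik jk.
have e1 : B p0 p0 = B p p by rewrite ep (rho_isom H).
have e2 : B p0 (rho g' *m p0) = (1 - 2 * gram b1 b2 b3) * B p p.
  by rewrite -gp ep /g' !rhoM -[RHS](rho_isom H h^-1%g) rhoK.
have : (1 - 2 * gram b1 b2 b3) * B p p <= (1 - 2 * gram0) * B p p.
  by rewrite -{1}e2 -e1; exact: le_trans l1 l2.
by rewrite ler_nM2r //; lra.
Qed.

(** The equality case of the minimality: inside the chamber a Bruhat step strictly increases the
    displacement, so [w] equals the Coxeter element below it. *)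
Lemma coxeter_of_displacement w p : (forall x, rho w *m x = x -> x = 0) ->
  (forall i, B p (nu i) < 0) ->
  B p (rho w *m p) = (1 - 2 * gram0) * B p p ->
  exists i j k, [/\ i != j, i != k, j != k & w = (s i * s j * s k)%g].
Proof.
move=> hw hp e; have [i [j [k [ij ik jk hb]]]] := exists_coxeter_subword hw.
exists i, j, k; split=> //.
have [//|] := bruhat_displacement_lt H hp hb.
by rewrite e ltNge (coxeter_displacement p ij ik jk).
Qed.

End Minimality.

(** * Factorizations of a glide reflection *)

Section Axis.
Variables (R : realType) (m : 'I_3 -> 'I_3 -> option nat).
Variables (W : groupType) (s : 'I_3 -> W) (nu : 'I_3 -> 'cV[R]_3).
Variables (rho : W -> 'M[R]_3) (w : W) (x0 q e : 'cV[R]_3) (ch sh : R).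
Notation E := 'cV[R]_3.
Notation B := (@lform R).
Notation T := (reflections s).
Notation lenT := (word_length (reflections s)).
Notation root_of := (root_of s nu rho).
Notation gram0 := (gram (nu 0) (nu 1) (nu ord_max)).
Hypothesis H : chamber_rep m s nu rho x0.
Hypotheses (qq : B q q = -1) (ee : B e e = 1) (qe : B q e = 0).
Hypotheses (ch_sh : ch ^+ 2 - sh ^+ 2 = 1) (sh_gt0 : 0 < sh) (ch_gt1 : 1 < ch).
Hypothesis wq : rho w *m q = ch *: q + sh *: e.
Hypothesis we : rho w *m e = sh *: q + ch *: e.
Hypothesis w_coxeter : exists i j k : 'I_3,
  [/\ i != j, i != k, j != k & w = (s i * s j * s k)%g].
Implicit Types (g h r t u v : W) (p x y z b : E).
Local Notation rhoM := (rhoM H).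
Local Notation rhoK := (rhoK H).
Local Notation rhoKV := (rhoKV H).
Local Notation rho1 := (rho1 H).

Lemma q_timelike : B q q < 0.
Proof. by rewrite qq ltrN10. Qed.

Lemma winv_q : rho w^-1%g *m q = ch *: q - sh *: e.
Proof.
rewrite -[RHS](rhoK w) mulmxBr -!scalemxAr wq we; congr (_ *m _).
apply/matrixP => i j; rewrite !mxE.
rewrite (_ : _ - _ = (ch ^+ 2 - sh ^+ 2) * q i j); last by ring.
by rewrite ch_sh mul1r.
Qed.

Lemma winv_e : rho w^-1%g *m e = ch *: e - sh *: q.
Proof.
rewrite -[RHS](rhoK w) mulmxBr -!scalemxAr wq we; congr (_ *m _).
apply/matrixP => i j; rewrite !mxE.
rewrite (_ : _ - _ = (ch ^+ 2 - sh ^+ 2) * e i j); last by ring.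
by rewrite ch_sh mul1r.
Qed.

Definition factor3 t1 b1 t2 b2 t3 b3 : Prop :=
  [/\ root_of t1 b1, root_of t2 b2, root_of t3 b3 & (t1 * t2 * t3)%g = w].

(** The skew form changes sign under [w], whereas the eigenvalues [ch + sh] and [ch - sh] of [w] on
    the plane of the axis are positive. *)
Lemma factor3_skew t1 b1 t2 b2 t3 b3 : factor3 t1 b1 t2 b2 t3 b3 ->
  skew_form b1 b2 b3 q = 0 /\ skew_form b1 b2 b3 e = 0.
Proof.
move=> [h1 h2 h3 ew].
have [u1 u2 u3] := And3 (root_unit H h1) (root_unit H h2) (root_unit H h3).
have sk x : skew_form b1 b2 b3 (rho w *m x) = - skew_form b1 b2 b3 x.
  by rewrite -ew (root_act3 H x h1 h2 h3) skew_form_triple_reflection.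
have := sk q; have := sk e; rewrite wq we !skew_formD.
have skZ k x : skew_form b1 b2 b3 (k *: x) = k * skew_form b1 b2 b3 x.
  by rewrite /skew_form !lformE; ring.
rewrite !skZ; set a := skew_form _ _ _ q; set d := skew_form _ _ _ e => h5 h6.
have a1 : (ch + 1) * ((ch + 1) * a) = sh ^+ 2 * a.
  have ea : (ch + 1) * a = - (sh * d) by move: h6; lra.
  have ed : (ch + 1) * d = - (sh * a) by move: h5; lra.
  by rewrite ea mulrN mulrCA ed; ring.
have a0 : a = 0.
  have : (2 * (ch + 1)) * a = 0.
    have -> : 2 * (ch + 1) * a = (ch + 1) * ((ch + 1) * a)
      - (ch ^+ 2 - 1) * a by ring.
    by rewrite a1 -ch_sh; ring.
  have /negbTE c0 : 2 * (ch + 1) != 0 by rewrite gt_eqF //; move: ch_gt1; lra.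
  by move/eqP; rewrite mulf_eq0 c0 => /eqP.
split=> //; move: h6; rewrite a0 !mulr0 oppr0 add0r => /eqP.
by rewrite mulf_eq0 gt_eqF //= => /eqP.
Qed.

(** The displacement of [q] depends on [w] alone, so all factorizations of [w] share one Gram
    determinant. *)
Lemma factor3_gram t1 b1 t2 b2 t3 b3 : factor3 t1 b1 t2 b2 t3 b3 ->
  gram b1 b2 b3 = (1 - ch) / 2.
Proof.
move=> hf; have [sq _] := factor3_skew hf; case: hf => [h1 h2 h3 ew].
have [u1 u2 u3] := And3 (root_unit H h1) (root_unit H h2) (root_unit H h3).
have := lform_triple_reflection u1 u2 u3 q.
rewrite -(root_act3 H q h1 h2 h3) ew wq sq !lformE qq qe expr0n /=; lra.
Qed.

Lemma coxeter_factor3 i j k : w = (s i * s j * s k)%g ->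
  factor3 (s i) (nu i) (s j) (nu j) (s k) (nu k).
Proof. by move=> ew; split=> //; exact: root_gen H _. Qed.

Lemma gram0E : gram0 = (1 - ch) / 2.
Proof.
have [i [j [k [ij ik jk ew]]]] := w_coxeter.
by rewrite -(factor3_gram (coxeter_factor3 ew)) gram_distinct.
Qed.

Lemma gram0_lt0 : gram0 < 0.
Proof. by rewrite gram0E pmulr_llt0 ?invr_gt0 // subr_lt0. Qed.

Lemma gram0_neq0 : gram0 != 0.
Proof. by rewrite lt_eqF // gram0_lt0. Qed.

Lemma factor3_gram_neq0 t1 b1 t2 b2 t3 b3 : factor3 t1 b1 t2 b2 t3 b3 ->
  gram b1 b2 b3 != 0.
Proof. by move=> /factor3_gram ->; rewrite -gram0E gram0_neq0. Qed.

(** Rotation and Hurwitz moves bring any two of the three factors to the front, so that statements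
    about the first two apply to every pair. *)
Lemma factor3_rotate t1 b1 t2 b2 t3 b3 : factor3 t1 b1 t2 b2 t3 b3 ->
  factor3 t2 b2 t3 b3 (w^-1 * t1 * w)%g (rho w^-1%g *m b1).
Proof.
move=> [h1 h2 h3 ew]; split=> //.
  by have := root_conj H w^-1%g h1; rewrite invgK.
have -> : (t2 * t3 = t1^-1 * w)%g by rewrite -ew !mulgA mulVg mul1g.
by rewrite !mulgA mulgK mulVg mul1g.
Qed.

Lemma factor3_swap t1 b1 t2 b2 t3 b3 : factor3 t1 b1 t2 b2 t3 b3 ->
  factor3 t1 b1 t3 b3 (t3 * t2 * t3)%g (reflect_along b3 b2).
Proof.
move=> [h1 h2 h3 ew]; split=> //; first exact: (root_reflect H h3 h2).
by rewrite -ew !mulgA -(mulgA t1) (root_sq H h3) mulg1.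
Qed.

Lemma factor3_opp12 t1 b1 t2 b2 t3 b3 : factor3 t1 b1 t2 b2 t3 b3 ->
  factor3 t2 b2 (t2 * t1 * t2)%g (reflect_along b2 b1) t3 b3.
Proof.
move=> [h1 h2 h3 ew]; split=> //; first exact: (root_reflect H h2 h1).
by rewrite -ew !mulgA (root_sq H h2) mul1g.
Qed.

(* The determinant of the projections of [x] and [y] to the plane of the axis,
   in the basis [(e, q)]. *)
Definition axis_det x y : R := B x q * B y e - B x e * B y q.

(** Compare the products of [e] with the images of [q] under [t1 * t2 = w * t3] and
    [t2 * t1 = t3 * w^-1]. Their difference is [- 4 * B b1 b2 * axis_det b1 b2]. *)
Lemma factor3_axis_det t1 b1 t2 b2 t3 b3 : factor3 t1 b1 t2 b2 t3 b3 ->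
  - 2 * B b1 b2 * axis_det b1 b2 = sh * (1 + B q b3 ^+ 2 - B e b3 ^+ 2).
Proof.
move=> [h1 h2 h3 ew].
have e1 : B (rho (t1 * t2)%g *m q) e = sh - 2 * B q b3 *
  (ch * B e b3 - sh * B q b3).
  have -> : (t1 * t2 = w * t3)%g by rewrite -ew -mulgA (root_sq H h3) mulg1.
  rewrite rhoM -{1}(rho_isom H w^-1%g) rhoK winv_e (root_act H _ h3).
  by rewrite /reflect_along !lformE qq qe (lformC b3 e) (lformC b3 q); ring.
have e2 : B (rho (t2 * t1)%g *m q) e = - sh - 2 * B e b3 *
  (ch * B q b3 - sh * B e b3).
  have -> : (t2 * t1 = t3 * w^-1)%g.
    rewrite -ew !invMg (root_inv H h1) (root_inv H h2) (root_inv H h3) !mulgA.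
    by rewrite (root_sq H h3) mul1g.
  rewrite rhoM winv_q (root_act H _ h3).
  by rewrite /reflect_along !lformE ee qe (lformC b3 e); ring.
move: e1 e2; rewrite !rhoM !(root_act H _ h1) !(root_act H _ h2).
rewrite /reflect_along !lformE /axis_det qe (lformC b2 b1) (lformC b1 q)
  (lformC b2 q).
lra.
Qed.

Lemma factor3_axis_det_sign t1 b1 t2 b2 t3 b3 : factor3 t1 b1 t2 b2 t3 b3 ->
  [/\ B b1 b2 < 0 -> 0 < axis_det b1 b2, 0 < B b1 b2 -> axis_det b1 b2 < 0 &
      B b1 b2 = 0 -> axis_det b1 b2 = 0].
Proof.
move=> hf; have eqd := factor3_axis_det hf; have [sq se] := factor3_skew hf.
have gr := factor3_gram hf; case: hf => [h1 h2 h3 ew].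
have [u1 u2 u3] := And3 (root_unit H h1) (root_unit H h2) (root_unit H h3).
(* The component of [b3] orthogonal to the axis. If it vanishes, then so does the skew form at [b3],
   which is [B b1 b2]. *)
pose v := b3 + B q b3 *: q - B e b3 *: e.
have vv : B v v = 1 + B q b3 ^+ 2 - B e b3 ^+ 2.
  rewrite /v !lformE u3 qq ee qe (lformC e q) qe (lformC b3 q) (lformC b3 e);
    ring.
have [v_ge0 v_eq0] : 0 <= B v v /\ (B v v = 0 -> v = 0).
  apply: (lform_orth_timelike q_timelike); rewrite /v !lformE qq qe; ring.
have pos : B b1 b2 != 0 -> 0 < - 2 * B b1 b2 * axis_det b1 b2.
  move=> g0; rewrite eqd -vv mulr_gt0 // lt_neqAle v_ge0 andbT eq_sym.
  apply/eqP => /v_eq0 v0; move/eqP: g0; apply.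
  have eb : b3 = - B q b3 *: q + B e b3 *: e.
    apply/matrixP => i j; move/matrixP/(_ i j): v0; rewrite /v !mxE; lra.
  have sk : skew_form b1 b2 b3 b3 = B b1 b2.
    by rewrite /skew_form u3 (lformC b3 b1) (lformC b3 b2); ring.
  have lin k l x y : skew_form b1 b2 b3 (k *: x + l *: y) =
      k * skew_form b1 b2 b3 x + l * skew_form b1 b2 b3 y.
    by rewrite /skew_form !lformE; ring.
  by have := lin (- B q b3) (B e b3) q e; rewrite -eb sk sq se !mulr0 addr0.
split=> hg.
- have := pos (ltr0_neq0 hg); rewrite pmulr_rgt0 //.
  by rewrite mulNr oppr_gt0 pmulr_rlt0.
- have := pos (lt0r_neq0 hg); rewrite nmulr_rgt0 //.
  by rewrite mulNr oppr_lt0 mulr_gt0.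
(* For orthogonal [b1] and [b2] with nonzero determinant, the vanishing of the skew form on the axis
   would make [b3] orthogonal to both; the Gram determinant would be 1, but it is negative. *)
have g1 : B b2 b3 * axis_det b1 b2 = 0.
  move: sq se; rewrite /skew_form /axis_det hg !mulr0 !addr0.
  rewrite (lformC q b1) (lformC q b2) (lformC e b1) (lformC e b2) => a1 a2.
  rewrite (_ : _ * _ = (B b1 q * B b2 b3) * B b2 e -
    (B b1 e * B b2 b3) * B b2 q); last ring.
  by rewrite (subr0_eq a1) (subr0_eq a2); ring.
have g2 : B b1 b3 * axis_det b1 b2 = 0.
  move: sq se; rewrite /skew_form /axis_det hg !mulr0 !addr0.
  rewrite (lformC q b1) (lformC q b2) (lformC e b1) (lformC e b2) => a1 a2.
  rewrite (_ : _ * _ = B b1 q * (B b2 e * B b1 b3) - B b1 e *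
    (B b2 q * B b1 b3)); last ring.
  by rewrite -(subr0_eq a1) -(subr0_eq a2); ring.
have [//|/eqP d0] := eqVneq (axis_det b1 b2) 0.
move: g1 g2 => /eqP + /eqP; rewrite !mulf_eq0 (negbTE (introN eqP d0)) !orbF.
move=> /eqP z1 /eqP z2; move: gr; rewrite /gram hg z1 z2; have := ch_gt1; lra.
Qed.

Hypothesis Hq : chamber_rep m s nu rho q.
Variable prec : rel W.
Notation R0 := (interval_reflections T w).
Hypothesis prec_order : strict_total_order_on R0 prec.
Hypothesis prec_axial : forall r1 r2, R0 r1 -> R0 r2 ->
  axially_before rho q e r1 r2 -> prec r1 r2.

Lemma reflections_generate g : exists a, factorization T g a.
Proof.
have [a ->] := rep_generated Hq g; exists [seq s i | i <- a].
split; last by rewrite big_map.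
by move=> x /mapP [i _ ->]; exists 1%g, i; rewrite conjg1.
Qed.

Lemma reflectionsJ t g : T t -> T (t ^ g)%g.
Proof. by move=> [h [i ->]]; exists (h * g)%g, i; rewrite conjgM. Qed.

Lemma root_reflection t b : root_of t b -> T t.
Proof. by move=> h; apply/(reflectionsP s nu rho); exists b. Qed.

Lemma positive_root t : T t -> exists2 b, root_of t b & B q b < 0.
Proof.
move=> /(reflectionsP s nu rho) [b hb]; have [qb|qb] := root_pos_neg Hq hb.
  by exists b.
by exists (- b); [exact: (root_opp Hq) | rewrite lformNr oppr_lt0].
Qed.

Lemma reflection_sign : exists2 sg : W -> bool,
  {morph sg : x y / (x * y)%g >-> x (+) y} & forall t, T t -> sg t = true.
Proof.
have [sg sgM sgs] := rep_sign Hq; exists sg => // t [g [i ->]].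
have sg1 : sg 1%g = false by have := sgM 1%g 1%g; rewrite mulg1; case: (sg 1%g).
have sgV : sg g^-1%g = sg g.
  by have := sgM g^-1%g g; rewrite mulVg sg1; case: (sg g); case: (sg _).
by rewrite conjgE !sgM sgs sgV; case: (sg g).
Qed.

Lemma lenT_parity : exists2 sg : W -> bool,
  (forall g, sg g = odd (lenT g)) /\ {morph sg : x y / (x * y)%g >-> x (+) y} &
  forall t, T t -> sg t = true.
Proof.
have [sg sgM sgT] := reflection_sign; exists sg => //; split=> // g.
exact: (word_length_parity reflections_generate sgM sgT).
Qed.

Lemma lenT_reflection t : T t -> lenT t = 1%N.
Proof.
move=> ht; have [sg [hs _] sgT] := lenT_parity.
have := word_length_letter reflections_generate ht.
by have := hs t; rewrite sgT //; case: (lenT t) => [|[|]].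
Qed.

Lemma lenT_w : lenT w = 3%N.
Proof.
have [i [j [k [_ _ _ ew]]]] := w_coxeter.
have [sg [hs sgM] sgT] := lenT_parity.
have Ts l : T (s l) by exact: root_reflection (root_gen Hq l).
have l3 : (lenT w <= 3)%N.
  have M := word_lengthM reflections_generate.
  rewrite ew (leq_trans (M _ _)) // (lenT_reflection (Ts k)) addn1 ltnS.
  by rewrite (leq_trans (M _ _)) // !(lenT_reflection (Ts _)).
(* Reflections are involutions, but [w * w] moves [q]: the image has the coefficient [2 * sh * ch]
   at [e]. *)
have n1 : lenT w <> 1%N.
  move=> /(word_length_eq1 reflections_generate)/positive_root [b hb _].
  have : rho w *m (rho w *m q) = q by rewrite -rhoM (root_sq Hq hb) rho1.
  rewrite wq mulmxDr -!scalemxAr wq we => /(congr1 (fun x => B x e)).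
  rewrite !lformE qe ee !mulr0 !mulr1 !add0r addrC => /eqP.
  rewrite (_ : _ + _ = 2 * sh * ch); last by ring.
  rewrite !mulf_eq0 (gt_eqF sh_gt0) pnatr_eq0 /= gt_eqF //.
  by apply: lt_trans ch_gt1.
have := hs w; rewrite {1}ew !sgM !sgT // => /esym.
by case: (lenT w) l3 n1 => [|[|[|[|]]]].
Qed.

Lemma lenT_pair t1 t2 t3 : T t1 -> T t2 -> T t3 -> (t1 * t2 * t3)%g = w ->
  lenT (t1 * t2)%g = 2%N.
Proof.
move=> h1 h2 h3 ew; have M := word_lengthM reflections_generate.
have := M (t1 * t2)%g t3; have := M t1 t2.
by rewrite ew lenT_w (lenT_reflection h1) (lenT_reflection h2)
  (lenT_reflection h3);
  case: (lenT _) => [|[|[|]]].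
Qed.

Lemma factor3_R0 t1 b1 t2 b2 t3 b3 : factor3 t1 b1 t2 b2 t3 b3 -> R0 t1.
Proof.
move=> hf; have [h1 h2 h3 ew] := hf; split; first exact: root_reflection h1.
rewrite /nc_interval /= /abs_le lenT_w (lenT_reflection (root_reflection h1)).
have [h1' _ h3' ew'] := factor3_rotate hf.
have -> : (t1^-1 * w = t2 * t3)%g by rewrite -ew !mulgA mulVg mul1g.
have T1 := root_reflection h1'; have T3 := root_reflection h3.
by rewrite (lenT_pair T1 T3 (root_reflection h3') ew').
Qed.

Lemma factor3_R0' t1 b1 t2 b2 t3 b3 : factor3 t1 b1 t2 b2 t3 b3 -> R0 t2.
Proof. by move=> /factor3_opp12; exact: factor3_R0. Qed.

Lemma prec_of_det t1 b1 t2 b2 : R0 t1 -> R0 t2 -> root_of t1 b1 ->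
  root_of t2 b2 -> B q b1 < 0 -> B q b2 < 0 -> 0 < axis_det b1 b2 -> prec t1 t2.
Proof.
move=> r1 r2 h1 h2 q1 q2 hd; apply: prec_axial => //.
apply: (axially_before_det (b1 := b1) (b2 := b2)) => //.
- by move=> x; exact: (root_act Hq).
- by move=> x; exact: (root_act Hq).
- exact: (root_unit Hq h1).
- exact: (root_unit Hq h2).
Qed.

Lemma prec_asym t1 t2 : R0 t1 -> R0 t2 -> prec t1 t2 -> prec t2 t1 -> False.
Proof.
have [irr tr _] := prec_order => h1 h2 h12 h21.
by have := irr _ h1; rewrite (tr _ _ _ h1 h2 h1 h12 h21).
Qed.

Lemma axis_detC x y : axis_det y x = - axis_det x y.
Proof. by rewrite /axis_det; ring. Qed.

(** The inequality is weak because orthogonal roots have determinant 0, so that their mutual order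
    is arbitrary. *)
Lemma factor3_prec_obtuse t1 b1 t2 b2 t3 b3 : factor3 t1 b1 t2 b2 t3 b3 ->
  B q b1 < 0 -> B q b2 < 0 -> prec t1 t2 -> B b1 b2 <= 0.
Proof.
move=> hf q1 q2 h12; rewrite leNgt; apply/negP => hg.
have r1 := factor3_R0 hf; have r2 := factor3_R0' hf.
have [_ hd _] := factor3_axis_det_sign hf; have [h1 h2 _ _] := hf.
apply: (prec_asym r1 r2 h12); apply: prec_of_det r2 r1 h2 h1 q2 q1 _.
by rewrite axis_detC oppr_gt0 hd.
Qed.

Lemma factor3_obtuse_prec t1 b1 t2 b2 t3 b3 : factor3 t1 b1 t2 b2 t3 b3 ->
  B q b1 < 0 -> B q b2 < 0 -> B b1 b2 < 0 -> prec t1 t2.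
Proof.
move=> hf q1 q2 hg; have [hd _ _] := factor3_axis_det_sign hf.
have [h1 h2 _ _] := hf.
exact: prec_of_det (factor3_R0 hf) (factor3_R0' hf) h1 h2 q1 q2 (hd hg).
Qed.

Lemma orthogonal_commute t1 b1 t2 b2 : root_of t1 b1 -> root_of t2 b2 ->
  B b1 b2 = 0 -> (t1 * t2 = t2 * t1)%g.
Proof.
move=> h1 h2 hg; apply: (rho_inj Hq) => x.
rewrite !rhoM !(root_act Hq _ h1) !(root_act Hq _ h2) /reflect_along !lformE.
rewrite (lformC b2) hg !mulr0 !subr0; apply/matrixP => i j; rewrite !mxE; ring.
Qed.

Lemma root_gram_coef t1 b1 t2 b2 t3 b3 k : root_of t1 b1 -> root_of t2 b2 ->
  root_of t3 b3 -> gram b1 b2 b3 = k ^+ 2 * gram0 -> k = 0 \/ 1 <= k ^+ 2.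
Proof.
move=> h1 h2 h3 gr; have [->|k0] := eqVneq k 0; [by left | right].
have hd : gram b1 b2 b3 != 0 by rewrite gr mulf_neq0 ?expf_neq0 ?gram0_neq0.
have := gram_roots_le Hq q_timelike gram0_neq0 h1 h2 h3 hd; rewrite gr.
by rewrite -{2}[gram0]mul1r ler_nM2r // gram0_lt0.
Qed.

(* Replacing [b1] by [b] multiplies the Gram determinant by [k ^+ 2]; by
   minimality it cannot decrease in absolute value. *)
Lemma factor3_coef t1 b1 t2 b2 t3 b3 r b k l : factor3 t1 b1 t2 b2 t3 b3 ->
  root_of r b -> b = k *: b1 + l *: b2 ->
  (k = 0 \/ 1 <= k ^+ 2) /\ (l = 0 \/ 1 <= l ^+ 2).
Proof.
move=> hf hr eb; have gr := factor3_gram hf; have [h1 h2 h3 _] := hf.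
have [u1 u2] := (root_unit Hq h1, root_unit Hq h2).
have gr' : gram b1 b2 b3 = gram0 by rewrite gr gram0E.
have gE y z : gram b y z = B b b + 2 * B b y * B b z * B y z
    - B b y ^+ 2 - B b z ^+ 2 - B b b * B y z ^+ 2.
  by rewrite (root_unit Hq hr) /gram; ring.
split.
  apply: (root_gram_coef hr h2 h3); rewrite -gr' gE eb /gram !lformE u1 u2.
  rewrite (lformC b2 b1); ring.
apply: (root_gram_coef hr h1 h3); rewrite -gr' gE eb /gram !lformE u1 u2.
rewrite (lformC b2 b1); ring.
Qed.

(** With coefficients of opposite signs, each of absolute value at least 1, the norm of [b] would be
    at least 2, as [B b1 b2 <= 0]. Positivity of [b] excludes the remaining cases. *)
Lemma factor3_cone t1 b1 t2 b2 t3 b3 r b k l : factor3 t1 b1 t2 b2 t3 b3 ->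
  B q b1 < 0 -> B q b2 < 0 -> B b1 b2 <= 0 -> root_of r b -> B q b < 0 ->
  b = k *: b1 + l *: b2 -> 0 <= k /\ 0 <= l.
Proof.
move=> hf q1 q2 hg hr qb eb; have [ck cl] := factor3_coef hf hr eb.
have [h1 h2 h3 _] := hf.
have [u1 u2] := (root_unit Hq h1, root_unit Hq h2).
have ub : 1 = k ^+ 2 + l ^+ 2 + 2 * (k * l) * B b1 b2.
  by rewrite -{1}(root_unit Hq hr) eb !lformE u1 u2 (lformC b2 b1); ring.
have opp : k * l < 0 -> False.
  move=> kl; have k0 : k <> 0 by move=> k0; move: kl; rewrite k0 mul0r ltxx.
  have l0 : l <> 0 by move=> l0; move: kl; rewrite l0 mulr0 ltxx.
  have := mulr_le0 (ltW kl) hg; case: ck cl => // ck [] // cl; lra.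
have qb' : B q b = k * B q b1 + l * B q b2 by rewrite eb !lformE.
have [k0|k0] := leP 0 k; have [l0|l0] := leP 0 l => //.
- have [kz|kp] := eqVneq k 0.
    have : 0 < l * B q b2 by rewrite nmulr_rgt0.
    by move: qb; rewrite qb' kz mul0r; lra.
  by case: opp; rewrite pmulr_rlt0 // lt_neqAle eq_sym kp.
- have [lz|lp] := eqVneq l 0.
    have : 0 < k * B q b1 by rewrite nmulr_rgt0.
    by move: qb; rewrite qb' lz mul0r; lra.
  by case: opp; rewrite pmulr_llt0 // lt_neqAle eq_sym lp.
have : 0 < k * B q b1 by rewrite nmulr_rgt0.
have : 0 < l * B q b2 by rewrite nmulr_rgt0.
by move: qb; rewrite qb'; lra.
Qed.

(** For the dual vector [f] of [b1], the product [t1 * t2] moves [f] by [- 2 *: b1], and [r1 * r2]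
    moves it by a combination of [c1] and [c2]. *)
Lemma factor3_span t1 b1 t2 b2 t3 b3 r1 c1 r2 c2 : factor3 t1 b1 t2 b2 t3 b3 ->
  root_of r1 c1 -> root_of r2 c2 -> (t1 * t2 = r1 * r2)%g ->
  exists k l, b1 = k *: c1 + l *: c2.
Proof.
move=> hf k1 k2 eu; have [h1 h2 h3 _] := hf.
have [u1 u2 u3] := And3 (root_unit Hq h1) (root_unit Hq h2) (root_unit Hq h3).
have [f [f1 f2 _]] := gram_dual u1 u2 u3 (factor3_gram_neq0 hf).
have : rho (t1 * t2)%g *m f = rho (r1 * r2)%g *m f by rewrite eu.
rewrite !rhoM (root_act Hq _ h1) (root_act Hq _ h2) (root_act Hq _ k1)
  (root_act Hq _ k2).
rewrite /reflect_along !lformE f1 f2 => e1.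
exists (B f c1 - 2 * B f c2 * B c2 c1), (B f c2).
apply/matrixP => i j; move/matrixP/(_ i j): e1; rewrite !mxE; lra.
Qed.

(** For unit vectors with [B x y = k], each new term is the negated reflection of the last but one
    along the last: the successive roots of a dihedral group. *)
Fixpoint chain (k : R) (x y : E) (n : nat) : E :=
  if n is n'.+1 then chain k y (2 * k *: y - x) n' else x.

Lemma chainSS (k : R) x y n :
  chain k x y n.+2 = 2 * k *: chain k x y n.+1 - chain k x y n.
Proof. by elim: n x y => [//|n IH] x y; rewrite [LHS]IH. Qed.

(** Consecutive terms of the chain are roots of a factorization of [u]. Were the next term negative,
    its opposite would give a factorization with product [- k < 0], which is not acute. *)
Lemma chain_roots u (k : R) : (forall t1 b1 t2 b2,
  root_of t1 b1 -> root_of t2 b2 ->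
    B q b1 < 0 -> B q b2 < 0 -> (t1 * t2)%g = u -> 0 < B b1 b2) ->
  forall t1 b1 t2 b2, root_of t1 b1 -> root_of t2 b2 ->
    B q b1 < 0 -> B q b2 < 0 -> (t1 * t2)%g = u -> B b1 b2 = k ->
  forall n, (exists r, root_of r (chain k b2 b1 n)) /\ B q
    (chain k b2 b1 n) < 0.
Proof.
move=> hu t1 b1 t2 b2 h1 h2 q1 q2 eu eg n.
elim: n t1 b1 t2 b2 h1 h2 q1 q2 eu eg =>
  [|n IH] t1 b1 t2 b2 h1 h2 q1 q2 eu eg /=.
  by split=> //; exists t2.
have hr : root_of (t1 * t2 * t1)%g (2 * k *: b1 - b2).
  have := root_opp Hq (root_reflect Hq h1 h2).
  by rewrite /reflect_along lformC eg opprB.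
have eu' : (t1 * t2 * t1 * t1)%g = u by rewrite -mulgA (root_sq Hq h1) mulg1.
have k' : B (2 * k *: b1 - b2) b1 = k.
  by rewrite !lformE (root_unit Hq h1) lformC eg; ring.
apply: (IH _ _ _ _ hr h1) => //; have [//|qr] := root_pos_neg Hq hr.
have := hu _ _ _ _ (root_opp Hq hr) h1; rewrite !lformNr !lformNl k'.
have := hu _ _ _ _ h1 h2 q1 q2 eu; rewrite eg oppr_lt0 => g0 /(_ qr q1 eu');
  lra.
Qed.

(* If every factorization of a product of two reflections were acute, the chain
   of its roots would consist of positive roots in both directions; the
   reflection [t2] exchanges the directions up to sign, so that the chain would
   consist of inversions of [t2] and hence be periodic. *)
Lemma exists_obtuse_factorization t1 b1 t2 b2 : root_of t1 b1 ->
  root_of t2 b2 ->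
  B q b1 < 0 -> B q b2 < 0 -> b1 <> b2 ->
  exists r1 c1 r2 c2, [/\ root_of r1 c1, root_of r2 c2,
    B q c1 < 0, B q c2 < 0 & (r1 * r2)%g = (t1 * t2)%g /\ B c1 c2 <= 0].
Proof.
move=> h1 h2 q1 q2 nb; apply: contrapT => none.
have hu r1 c1 r2 c2 : root_of r1 c1 -> root_of r2 c2 -> B q c1 < 0 ->
    B q c2 < 0 -> (r1 * r2)%g = (t1 * t2)%g -> 0 < B c1 c2.
  move=> k1 k2 p1 p2 eu; rewrite ltNge; apply/negP => hg; apply: none.
  by exists r1, c1, r2, c2.
have hu' r1 c1 r2 c2 : root_of r1 c1 -> root_of r2 c2 -> B q c1 < 0 ->
    B q c2 < 0 -> (r1 * r2)%g = (t2 * t1)%g -> 0 < B c1 c2.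
  move=> k1 k2 p1 p2 eu; rewrite lformC; apply: (hu r2 c2 r1 c1) => //.
  apply: invg_inj; rewrite !invMg (root_inv Hq k1) (root_inv Hq k2) eu.
  by rewrite (root_inv Hq h1) (root_inv Hq h2).
pose g := B b1 b2; have eg' : B b2 b1 = g by rewrite lformC.
have fw := chain_roots hu h1 h2 q1 q2 erefl erefl.
have bw := chain_roots hu' h2 h1 q2 q1 erefl eg'.
have [L hL] := inversions_finite Hq gram0_neq0 t2.
have flip n : reflect_along b2 (chain g b2 b1 n) = - chain g b1 b2 n.+1.
  suff [] : reflect_along b2 (chain g b2 b1 n) = - chain g b1 b2 n.+1 /\
    reflect_along b2 (chain g b2 b1 n.+1) = - chain g b1 b2 n.+2 by [].
  elim: n => [|n [IH1 IH2]]; last first.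
    split=> //; rewrite chainSS (chainSS g b1).
    rewrite /reflect_along in IH1 IH2 *; rewrite !lformE.
    move/(canRL (subrK _)): IH1 => IH1; move/(canRL (subrK _)): IH2 => IH2.
    apply/matrixP => i j; move/matrixP/(_ i j): IH1; move/matrixP/(_ i j): IH2.
    rewrite !mxE => -> ->; ring.
  split; first by rewrite /= reflect_along_self ?(root_unit Hq h2).
  by rewrite /= /reflect_along -/g opprB.
have mem n : chain g b2 b1 n \in L.
  have [[r hr] qr] := fw n; apply: hL hr qr _.
  by rewrite (root_inv Hq h2) (root_act Hq _ h2) flip lformNr oppr_gt0;
    case: (bw n.+1).
(* Two consecutive terms determine the rest of the chain; by the pigeonhole principle some pair
   recurs. *)
pose f n := (chain g b2 b1 n, chain g b2 b1 n.+1).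
pose LL := [seq (x, y) | x <- L, y <- L].
have : ~~ uniq (mkseq f (size LL).+1).
  apply/negP => uf; have sub : {subset mkseq f (size LL).+1 <= LL}.
    by move=> _ /mapP [n _ ->]; apply/allpairsP; exists (f n); split=> //;
      [exact: mem n | exact: mem n.+1].
  by have := uniq_leq_size uf sub; rewrite size_mkseq ltnn.
move=> /(uniqPn (f 0%N)) [i [j [ij]]]; rewrite size_mkseq => jn.
rewrite !nth_mkseq ?(ltn_trans ij jn) // => eij.
have ei : chain g b2 b1 i = chain g b2 b1 j := congr1 fst eij.
have ej : chain g b2 b1 i.+1 = chain g b2 b1 j.+1 := congr1 snd eij.
(* The sum over a period is invariant under shifts and nonzero on [q], so the recursion forces
   [g = 1]. *)
pose S k := \sum_(i <= n < j) chain g b2 b1 (n + k).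
have qS : B q (S 0%N) < 0.
  rewrite /S lformC lform_suml big_ltn // addn0.
  apply: ltr_wnDr; last by rewrite lformC; case: (fw i).
  by rewrite sumr_le0 // => n _; rewrite lformC addn0 ltW //; case: (fw n).
have S1 : S 1%N = S 0%N.
  apply/eqP; rewrite -subr_eq0 /S -sumrB.
  under eq_bigr do rewrite addn0 addn1.
  by rewrite telescope_sumr ?(ltnW ij) // -ei subrr.
have S2 : S 2%N = S 1%N.
  apply/eqP; rewrite -subr_eq0 /S -sumrB.
  under eq_bigr do rewrite addn1 addn2.
  by rewrite (telescope_sumr (fun n =>
    chain g b2 b1 n.+1)) ?(ltnW ij) // -ej subrr.
have S3 : S 2%N = 2 * g *: S 1%N - S 0%N.
  rewrite /S scaler_sumr -sumrB; apply: eq_bigr => n _.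
  by rewrite addn2 addn1 addn0 chainSS.
have g1 : g = 1.
  have := congr1 (B q) S3; rewrite S2 S1 !lformE => h.
  have /eqP : (g - 1) * B q (S 0%N) = 0 by lra.
  by rewrite mulf_eq0 (lt_eqF qS) orbF subr_eq0 => /eqP.
(* For [g = 1] the chain is an arithmetic progression, which repeats a term only if [b1 = b2]. *)
have lin n : chain g b2 b1 n = b2 + n%:R *: (b1 - b2).
  suff [] : chain g b2 b1 n = b2 + n%:R *: (b1 - b2) /\
    chain g b2 b1 n.+1 = b2 + n.+1%:R *: (b1 - b2) by [].
  elim: n => [|n [IH1 IH2]].
    by rewrite /= scale0r addr0 scale1r addrC subrK.
  split=> //; rewrite chainSS IH1 IH2 g1; apply/matrixP => a c; rewrite !mxE.
  by rewrite -[n.+2]addn2 -[n.+1]addn1 !natrD; ring.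
have : (j%:R - i%:R : R) *: (b1 - b2) = 0.
  have := ei; rewrite !lin => /addrI h.
  by rewrite scalerBl h subrr.
move/eqP; rewrite scaler_eq0 subr_eq0 eqr_nat (gtn_eqF ij) subr_eq0.
by move/eqP.
Qed.

Lemma factor3_neq t1 b1 t2 b2 t3 b3 : factor3 t1 b1 t2 b2 t3 b3 -> t1 <> t2.
Proof.
move=> [h1 h2 h3 ew] e12; have := lenT_w.
by rewrite -ew e12 (root_sq Hq h2) mul1g (lenT_reflection (root_reflection h3)).
Qed.

(** An obtuse factorization with nonzero product is increasing; if the roots are orthogonal, the
    reflections commute and can be put in order. *)
Lemma pair_increasing t1 b1 t2 b2 t3 b3 : factor3 t1 b1 t2 b2 t3 b3 ->
  exists r1 c1 r2 c2, [/\ factor3 r1 c1 r2 c2 t3 b3,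
    B q c1 < 0, B q c2 < 0, (r1 * r2 = t1 * t2)%g & prec r1 r2].
Proof.
move=> hf; have [h1 h2 h3 ew] := hf.
have [p1 k1 q1] := positive_root (root_reflection h1).
have [p2 k2 q2] := positive_root (root_reflection h2).
have np : p1 <> p2.
  by move=> ep; apply: (factor3_neq hf); apply: (root_inj Hq k1); rewrite ep.
have [r1 [c1 [r2 [c2 [m1 m2 n1 n2 [eu hg]]]]]] :=
  exists_obtuse_factorization k1 k2 q1 q2 np.
have hf' : factor3 r1 c1 r2 c2 t3 b3 by split=> //; rewrite eu.
have [g0|/eqP g0] := eqVneq (B c1 c2) 0; last first.
  exists r1, c1, r2, c2; split=> //.
  by apply: (factor3_obtuse_prec hf') => //; rewrite lt_neqAle hg andbT;
    apply/eqP.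
have com := orthogonal_commute m1 m2 g0.
have [_ _ tot] := prec_order.
have /orP [h|h] := tot _ _ (factor3_R0 hf') (factor3_R0' hf') (factor3_neq hf').
  by exists r1, c1, r2, c2.
exists r2, c2, r1, c1; split=> //; last by rewrite -com.
by split=> //; rewrite -com eu.
Qed.

Lemma positive_multiple r1 b1 r2 b2 k : root_of r1 b1 -> root_of r2 b2 ->
  B q b1 < 0 -> B q b2 < 0 -> b2 = k *: b1 -> r2 = r1.
Proof.
move=> h1 h2 q1 q2 eb; have := root_unit Hq h2.
rewrite eb !lformE (root_unit Hq h1) mulr1 -expr2 => /eqP.
rewrite sqrf_eq1 => /orP [] /eqP ek.
  by apply: (root_inj Hq h2); rewrite eb ek scale1r.
by move: q2; rewrite eb ek !lformE mulN1r oppr_lt0 => /(lt_trans q1);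
  rewrite ltxx.
Qed.

(** Since [c1 = k *: b1 + l *: b2] with nonnegative coefficients, its determinant with [b1] is
    [l * axis_det b1 b2], which is positive unless [l = 0] or the roots are orthogonal. *)
Lemma pair_first_le t1 b1 t2 b2 t3 b3 r1 c1 r2 c2 :
  factor3 t1 b1 t2 b2 t3 b3 -> B q b1 < 0 -> B q b2 < 0 -> prec t1 t2 ->
  root_of r1 c1 -> root_of r2 c2 -> B q c1 < 0 -> (r1 * r2 = t1 * t2)%g ->
  r1 = t1 \/ prec t1 r1.
Proof.
move=> hf q1 q2 h12 m1 m2 n1 eu; have [h1 h2 h3 ew] := hf.
have hf' : factor3 r1 c1 r2 c2 t3 b3 by split=> //; rewrite eu.
have hg := factor3_prec_obtuse hf q1 q2 h12.
have [k [l ec]] := factor3_span hf' h1 h2 eu.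
have [k0 l0] := factor3_cone hf q1 q2 hg m1 n1 ec.
have [lz|lp] := eqVneq l 0.
  left; apply: (positive_multiple h1 m1 q1 n1 (k := k)).
  by rewrite ec lz scale0r addr0.
right; have lpos : 0 < l by rewrite lt_neqAle eq_sym lp.
have [g0|g0] := eqVneq (B b1 b2) 0; last first.
  apply: (prec_of_det (factor3_R0 hf) (factor3_R0 hf') h1 m1 q1 n1).
  rewrite ec (_ : axis_det _ _ = l * axis_det b1 b2); last first.
    by rewrite /axis_det !lformE; ring.
  rewrite mulr_gt0 //; have [hd _ _] := factor3_axis_det_sign hf.
  by apply: hd; rewrite lt_neqAle g0.
have [_ [/eqP|l1]] := factor3_coef hf m1 ec; first by rewrite (negbTE lp).
have := root_unit Hq m1; rewrite ec !lformE (root_unit Hq h1) (root_unit Hq h2).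
rewrite (lformC b2) g0 => e1.
have /eqP : k ^+ 2 = 0.
  by apply/eqP; rewrite eq_le sqr_ge0 andbT; move: e1 l1; rewrite !expr2; lra.
rewrite sqrf_eq0 => /eqP kz.
rewrite (_ : r1 = t2) //; apply: (positive_multiple h2 m1 q2 n1 (k := l)).
by rewrite ec kz scale0r add0r.
Qed.

(** By [pair_first_le] an increasing factorization has the least first factor; two increasing ones
    therefore have the same first factor and agree. *)
Lemma pair_EL t1 t2 t3 : T t1 -> T t2 -> T t3 -> (t1 * t2 * t3)%g = w ->
  exists v1 v2, [/\ T v1, T v2, (v1 * v2 = t1 * t2)%g, prec v1 v2 &
  forall r1 r2, T r1 -> T r2 -> (r1 * r2 = t1 * t2)%g ->
    (r1 = v1 /\ r2 = v2) \/ prec v1 r1 /\ ~~ prec r1 r2].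
Proof.
move=> T1 T2 T3 ew.
have [b1 h1 _] := positive_root T1; have [b2 h2 _] := positive_root T2.
have [b3 h3 _] := positive_root T3.
have hf : factor3 t1 b1 t2 b2 t3 b3 by split.
have [v1 [c1 [v2 [c2 [hx n1 n2 ex px]]]]] := pair_increasing hf.
have [m1 m2 _ _] := hx.
exists v1, v2; split=> //;
  [exact: root_reflection m1 | exact: root_reflection m2 |].
move=> r1 r2 /positive_root [d1 k1 p1] /positive_root [d2 k2 p2] er.
have hr : factor3 r1 d1 r2 d2 t3 b3 by split=> //; rewrite er.
have er' : (r1 * r2 = v1 * v2)%g by rewrite er ex.
have [e1|l1] := pair_first_le hx n1 n2 px k1 k2 p1 er'.
  by left; split=> //; apply: (mulgI r1); rewrite er' e1.
right; split=> //; apply/negP => l2.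
have [e1|l3] := pair_first_le hr p1 p2 l2 m1 m2 n1 (esym er').
  have [irr _ _] := prec_order.
  by have := irr _ (factor3_R0 hx); rewrite {2}e1 l1.
exact: prec_asym (factor3_R0 hx) (factor3_R0 hr) l1 l3.
Qed.

Lemma nu_obtuse i j : i != j -> -1 <= B (nu i) (nu j) <= 0.
Proof.
move=> ij; rewrite (rep_angle Hq ij) lerN2 oppr_le0 cos_le1 /=.
case em: (m i j) => [k|]; rewrite /angle ?cos0 ?ler01 //.
have [_ _ /(_ _ _ _ ij em) k2] := rep_matrix Hq.
have kp : 0 < k%:R :> R by rewrite ltr0n (leq_trans _ k2).
apply: cos_ge0_pihalf; rewrite ler_pdivlMr // ler_pdivrMr //.
have := pi_ge0 R; have k2' : 2 <= k%:R :> R by rewrite ler_nat.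
move=> pi0; apply/andP; split.
  by have := mulr_ge0 pi0 (ltW kp); lra.
by have := ler_wpM2l pi0 k2'; lra.
Qed.

(** If [nu i] were orthogonal to both other simple roots, the Gram determinant would be
    [1 - B (nu j) (nu k) ^+ 2 >= 0]. *)
Lemma nu_orthogonal_once i j k : i != j -> i != k -> j != k ->
  B (nu i) (nu j) = 0 -> B (nu i) (nu k) < 0.
Proof.
move=> ij ik jk hg; have /andP [_ le0] := nu_obtuse ik.
rewrite lt_neqAle le0 andbT; apply/eqP => hg'.
have := gram0_lt0; rewrite -(gram_distinct nu ij ik jk) /gram hg hg'.
have /andP [l1 l2] := nu_obtuse jk.
have : B (nu j) (nu k) ^+ 2 <= 1 by rewrite expr2; nra.
lra.
Qed.

Lemma nu_inside i : B q (nu i) < 0.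
Proof. exact: rep_inside Hq i. Qed.

(** Neighbouring generators with nonorthogonal roots are already in order; at most one neighbouring
    pair is orthogonal, and then it commutes and may be exchanged. *)
Lemma increasing_coxeter : exists i j k, [/\ i != j, i != k, j != k,
  w = (s i * s j * s k)%g & prec (s i) (s j) /\ prec (s j) (s k)].
Proof.
have [i [j [k [ij ik jk ew]]]] := w_coxeter; have hf := coxeter_factor3 ew.
have hf23 := factor3_rotate hf; have hf13 := factor3_swap hf.
have p12 := factor3_obtuse_prec hf (nu_inside i) (nu_inside j).
have p13 := factor3_obtuse_prec hf13 (nu_inside i) (nu_inside k).
have p23 := factor3_obtuse_prec hf23 (nu_inside j) (nu_inside k).
have [_ _ tot] := prec_order.
have [g12|g12] := eqVneq (B (nu i) (nu j)) 0.
  have h13 := p13 (nu_orthogonal_once ij ik jk g12).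
  have h23 : prec (s j) (s k).
    by apply/p23/(nu_orthogonal_once _ jk ik); rewrite 1?eq_sym // lformC.
  have /orP [h|h] := tot _ _ (factor3_R0 hf) (factor3_R0' hf) (factor3_neq hf).
    by exists i, j, k.
  exists j, i, k; split; rewrite // 1?eq_sym // ew.
  by rewrite (orthogonal_commute (root_gen Hq i) (root_gen Hq j) g12).
have h12 : prec (s i) (s j).
  by apply: p12; rewrite lt_neqAle g12; have /andP [] := nu_obtuse ij.
have [g23|g23] := eqVneq (B (nu j) (nu k)) 0; last first.
  exists i, j, k; split=> //; split=> //.
  by apply: p23; rewrite lt_neqAle g23; have /andP [] := nu_obtuse jk.
have h13 : prec (s i) (s k).
  apply: p13; rewrite lformC; apply: (@nu_orthogonal_once k j i);
    by rewrite 1?eq_sym // lformC.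
have /orP [h|h] := tot _ _ (factor3_R0 hf23) (factor3_R0' hf23)
  (factor3_neq hf23).
  by exists i, j, k.
exists i, k, j; split; rewrite // 1?eq_sym // ew -!mulgA.
by rewrite (orthogonal_commute (root_gen Hq j) (root_gen Hq k) g23).
Qed.

(** * Factorizations of the Coxeter element itself *)

Section IncreasingCoxeter.
Variables i j k : 'I_3.
Hypotheses (ij : i != j) (ik : i != k) (jk : j != k).
Hypothesis w_ijk : w = (s i * s j * s k)%g.
Hypotheses (prec_ij : prec (s i) (s j)) (prec_jk : prec (s j) (s k)).

Let hf := coxeter_factor3 w_ijk.
Let hf13 := factor3_swap hf.

Lemma prec_ik : prec (s i) (s k).
Proof.
have [_ tr _] := prec_order.
exact: tr _ _ _ (factor3_R0 hf) (factor3_R0' hf)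
  (factor3_R0' hf13) prec_ij prec_jk.
Qed.

Lemma sum_ijk (V : nmodType) (F : 'I_3 -> V) : \sum_l F l = F i + F j + F k.
Proof.
rewrite (bigD1 i) //= (bigD1 j) 1?eq_sym //= (bigD1 k) /=; last first.
  by rewrite eq_sym ik eq_sym jk.
rewrite big_pred0 ?addr0 ?addrA // => l.
by have [->|->|->] := other_two_cover l ij ik jk; rewrite eqxx ?andbF.
Qed.

Lemma axis_det_nu_ge0 l : i != l -> (l = j \/ l = k) ->
  0 <= axis_det (nu i) (nu l) /\
  (axis_det (nu i) (nu l) = 0 -> B (nu i) (nu l) = 0).
Proof.
move=> il lc.
have [hd1 _ hd3] : [/\ B (nu i) (nu l) < 0 -> 0 < axis_det (nu i) (nu l),
  0 < B (nu i) (nu l) -> axis_det (nu i) (nu l) < 0 &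
  B (nu i) (nu l) = 0 -> axis_det (nu i) (nu l) = 0].
  case: lc => ->; [exact: factor3_axis_det_sign hf|exact:
    factor3_axis_det_sign hf13].
have /andP [_] : -1 <= B (nu i) (nu l) <= 0 by exact: nu_obtuse.
rewrite le_eqVlt => /predU1P [g0|g0]; first by rewrite hd3.
by have h := hd1 g0; split=> [|h0]; [exact: ltW | move: h; rewrite h0 ltxx].
Qed.

(** The positive root [b] is a nonnegative combination of simple roots, so its determinant with
    [nu i] is nonnegative. It vanishes only if [b] lies in the span of [nu i] and at most one simple
    root orthogonal to it. *)
Lemma first_reflection_le r : R0 r -> r = s i \/ prec (s i) r.
Proof.
move=> hr; have [Tr _] := hr; have [b hb qb] := positive_root Tr.
have [c c0 eb] := root_nonneg Hq hb qb; rewrite sum_ijk in eb.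
have [dj0 dj] := axis_det_nu_ge0 ij (or_introl erefl).
have [dk0 dk] := axis_det_nu_ge0 ik (or_intror erefl).
have ed : axis_det (nu i) b =
    c j * axis_det (nu i) (nu j) + c k * axis_det (nu i) (nu k).
  by rewrite eb /axis_det !lformE; ring.
have cj := mulr_ge0 (c0 j) dj0; have ck := mulr_ge0 (c0 k) dk0.
have [hd|hd] := ltP 0 (axis_det (nu i) b).
  right; apply: prec_of_det (factor3_R0 hf) hr (root_gen Hq i) hb
    (nu_inside i) qb hd.
have zj : c j * axis_det (nu i) (nu j) = 0 by lra.
have zk : c k * axis_det (nu i) (nu k) = 0 by lra.
(* As for pairs, a unit vector whose nonzero coefficients have absolute value at least 1 must be one
   of the two orthogonal roots. *)
have orth l : prec (s i) (s l) -> B (nu i) (nu l) = 0 -> i != l ->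
    (l = j \/ l = k) -> b = c i *: nu i + c l *: nu l ->
      r = s i \/ prec (s i) r.
  move=> pil g0 il lc eb'.
  have [cl|cl] := eqVneq (c l) 0.
    left; apply: (positive_multiple (root_gen Hq i) hb (nu_inside i) qb (k :=
      c i)).
    by rewrite eb' cl scale0r addr0.
  have [_ [/eqP|l1]] : (c i = 0 \/ 1 <= c i ^+ 2) /\ (c l = 0 \/ 1 <= c l ^+ 2).
      case: lc eb' => -> eb'; [exact: factor3_coef hf hb eb'|].
      exact: factor3_coef hf13 hb eb'.
    by rewrite (negbTE cl).
  have := root_unit Hq hb; rewrite eb' !lformE
    !(rep_unit Hq) (lformC (nu l)) g0 => e1.
  have /eqP : c i ^+ 2 = 0.
    by apply/eqP; rewrite eq_le sqr_ge0 andbT; move: e1 l1; rewrite !expr2; lra.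
  rewrite sqrf_eq0 => /eqP ci.
  right; rewrite (_ : r = s l) //.
  apply: (positive_multiple (root_gen Hq l) hb (nu_inside l) qb (k := c l)).
  by rewrite eb' ci scale0r add0r.
have [cj0|cj0] := eqVneq (c j) 0.
  have eb' : b = c i *: nu i + c k *: nu k by rewrite eb cj0 scale0r addr0.
  have [ck0|ck0] := eqVneq (c k) 0.
    left; apply: (positive_multiple (root_gen Hq i) hb (nu_inside i) qb (k :=
      c i)).
    by rewrite eb' ck0 scale0r addr0.
  apply: (orth k) => //; [exact: prec_ik | | by right].
  by apply: dk; move/eqP: zk; rewrite mulf_eq0 (negbTE ck0) => /eqP.
have gj : B (nu i) (nu j) = 0.
  by apply: dj; move/eqP: zj; rewrite mulf_eq0 (negbTE cj0) => /eqP.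
have gk := nu_orthogonal_once ij ik jk gj.
have ck0 : c k = 0.
  apply/eqP; move/eqP: zk; rewrite mulf_eq0 => /orP [//|/eqP /dk gk0].
  by move: gk; rewrite gk0 ltxx.
apply: (orth j) => //; first by left.
by rewrite eb ck0 scale0r addr0.
Qed.

(** Apply [s i], [s j], [s k] in turn: the root can become negative only at a step where it equals
    the simple root being reflected. *)
Lemma coxeter_inversions r b : root_of r b -> B q b < 0 ->
  0 < B q (rho w^-1%g *m b) ->
  b \in [:: nu i; reflect_along (nu i) (nu j);
            reflect_along (nu i) (reflect_along (nu j) (nu k))].
Proof.
move=> hb qb; rewrite w_ijk !invMg !(gen_inv Hq) !rhoM !(rho_gen Hq) => hn.
have perm := gen_permutes_pos Hq gram0_neq0.
have rf l t c := @root_reflect _ _ _ _ _ _ _ Hq _ _ t c (root_gen Hq l).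
have K l x := @reflect_alongK _ (nu l) x (rep_unit Hq l).
rewrite !inE; have [//|/eqP n1] := eqVneq b (nu i); rewrite /=.
have r1 := rf i _ _ hb; have p1 := perm i _ _ hb qb n1.
have [e1|/eqP n2] := eqVneq (reflect_along (nu i) b) (nu j).
  by rewrite -e1 K eqxx.
have r2 := rf j _ _ r1; have p2 := perm j _ _ r1 p1 n2.
have [e2|/eqP n3] := eqVneq (reflect_along (nu j) (reflect_along (nu i) b))
  (nu k).
  by rewrite -e2 !K eqxx orbT.
by have := perm k _ _ r2 p2 n3; move: hn; lra.
Qed.

(** A simple root spans an extremal ray of the cone of nonnegative combinations, as its other
    coefficients are 0. *)
Lemma simple_extremal l r b x : root_of r b -> B q b < 0 -> nonneg nu x ->
  nu l = b + x -> r = s l.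
Proof.
move=> hb qb nx el; have nb := root_nonneg Hq hb qb.
case: nb => c c0 eb.
have cz a : a != l -> c a = 0.
  move=> al; have [f fa] := dual_vector Hq gram0_neq0 a.
  have := fa l; rewrite el lformDr eq_sym (negbTE al) /=.
  have := nonneg_dual fa nx; rewrite eb (dual_sum _ fa); have := c0 a; lra.
apply: (positive_multiple (root_gen Hq l) hb (nu_inside l) qb (k := c l)).
by rewrite eb (bigD1 l) //= big1 ?addr0 // => a /cz ->; rewrite scale0r.
Qed.

(* The inversions of [w] are those of the given factorization; the simple root
   [nu i] is one of them, and it is extremal among the positive roots. *)
Lemma obtuse_factor3_first t1 b1 t2 b2 t3 b3 : factor3 t1 b1 t2 b2 t3 b3 ->
  B q b1 < 0 -> B q b2 < 0 -> B q b3 < 0 ->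
  B b1 b2 <= 0 -> B b1 b3 <= 0 -> B b2 b3 <= 0 ->
  [\/ t1 = s i, t2 = s i | t3 = s i].
Proof.
move=> hb q1 q2 q3 g12 g13 g23; have [h1 h2 h3 ew] := hb.
have [u1 u2 u3] := And3 (root_unit Hq h1) (root_unit Hq h2) (root_unit Hq h3).
have rf t c t' c' := @root_reflect _ _ _ _ _ _ _ Hq t c t' c'.
have K c x := @reflect_alongK R c x.
(* Besides [b1], these are the candidate inversions of [t1 * t2 * t3]. Obtuseness makes them
   nonnegative combinations of the [b]'s, hence positive, and makes their images under the inverse
   of [w] negative. *)
pose c2 := reflect_along b1 b2;
  pose c3 := reflect_along b1 (reflect_along b2 b3).
have g1223 := mulr_le0 g12 g23.
have e2 : c2 = b2 + (- 2 * B b1 b2) *: b1.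
  by rewrite /c2 /reflect_along lformC -scaleNr mulNr.
have e3 : c3 = b3 + ((- 2 * B b2 b3) *: b2 +
    (- 2 * B b1 b3 + 4 * (B b1 b2 * B b2 b3)) *: b1).
  rewrite /c3 /reflect_along !lformE (lformC b3 b2) (lformC b3 b1)
    (lformC b2 b1).
  by apply/matrixP => a c; rewrite !mxE; ring.
have qc2 : B q c2 < 0.
  rewrite e2 !lformE; have := mulr_le0 g12 (ltW q1); lra.
have qc3 : B q c3 < 0.
  rewrite e3 !lformE; have := mulr_le0 g23 (ltW q2);
    have := mulr_le0 g13 (ltW q1).
  have := mulr_ge0_le0 g1223 (ltW q1); lra.
have qd2 : B q (reflect_along b3 b2) < 0.
  rewrite /reflect_along !lformE; have := mulr_le0 g23 (ltW q3); lra.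
have qd1 : B q (reflect_along b3 (reflect_along b2 b1)) < 0.
  rewrite /reflect_along !lformE.
  have := mulr_le0 g12 (ltW q2); have := mulr_le0 g13 (ltW q3).
  have := mulr_ge0_le0 g1223 (ltW q3); lra.
have winv x : rho w^-1%g *m x = reflect_along b3 (reflect_along b2
  (reflect_along b1 x)).
  rewrite -ew !invMg (root_inv Hq h1) (root_inv Hq h2) (root_inv Hq h3) mulgA.
  exact: (root_act3 Hq x h3 h2 h1).
have rN c x : reflect_along c (- x) = - reflect_along c x.
  by apply/matrixP => a d; rewrite /reflect_along !lformE !mxE; ring.
pose N := [:: nu i; reflect_along (nu i) (nu j);
            reflect_along (nu i) (reflect_along (nu j) (nu k))].
have m1 : b1 \in N.
  apply: (coxeter_inversions h1) => //.
  by rewrite winv (reflect_along_self u1) !rN lformNr oppr_gt0.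
have m2 : c2 \in N.
  apply: (coxeter_inversions (rf _ _ _ _ h1 h2)) => //.
  by rewrite winv /c2 K // (reflect_along_self u2) !rN lformNr oppr_gt0.
have m3 : c3 \in N.
  apply: (coxeter_inversions (rf _ _ _ _ h1 (rf _ _ _ _ h2 h3))) => //.
  by rewrite winv /c3 !K // (reflect_along_self u3) lformNr oppr_gt0.
have gr := factor3_gram_neq0 hb.
have gr2 : gram b2 b1 b3 != 0 by rewrite gramCl.
have gr3 : gram b3 b1 b2 != 0 by rewrite gramCl gramCr.
have [f2 [f22 f21 _]] := gram_dual u2 u1 u3 gr2.
have [f3 [f33 f31 f32]] := gram_dual u3 u1 u2 gr3.
have uM : uniq [:: b1; c2; c3].
  rewrite /= !inE negb_or !andbT; apply/andP; split; [apply/andP; split|];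
    apply/eqP.
  - move=> /(congr1 (B f2)); rewrite e2 !lformE f22 f21 mulr0 addr0 => /eqP.
    by rewrite eq_sym oner_eq0.
  - move=> /(congr1 (B f3));
    rewrite e3 !lformE f33 f31 f32 !mulr0 !addr0 => /eqP.
    by rewrite eq_sym oner_eq0.
  - move=> /(congr1 (B f3));
    rewrite e2 e3 !lformE f33 f31 f32 !mulr0 !addr0 => /eqP.
    by rewrite eq_sym oner_eq0.
have sub : {subset [:: b1; c2; c3] <= N}.
  move=> x; rewrite mem_seq3 => /or3P [] /eqP ->;
    [exact: m1|exact: m2|exact: m3].
(* Three distinct inversions in a list of three exhaust it, so [nu i] is among them. *)
have [_ mem] := uniq_min_size uM sub (leqnn 3).
have n1 := root_nonneg Hq h1 q1; have n2 := root_nonneg Hq h2 q2.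
have : nu i \in [:: b1; c2; c3] by rewrite mem mem_head.
rewrite !inE => /or3P [] /eqP ei.
- constructor 1; apply: (simple_extremal h1 q1 (x := 0)); last by rewrite addr0.
  by rewrite -(scale0r (nu i)); apply: nonnegZ => //; exact: nonneg_nu.
- constructor 2; apply: (simple_extremal h2 q2 _ (etrans ei e2)).
  by apply: nonnegZ => //; lra.
constructor 3; apply: (simple_extremal h3 q3 _ (etrans ei e3)).
by apply: nonnegD; apply: nonnegZ => //; lra.
Qed.

(** If [r1 = s i], the claim reduces to the factorizations of [s j * s k]. Otherwise [s i] precedes
    [r1]; an increasing factorization would be obtuse, so would contain [s i], although all its
    factors come after [s i]. *)
Lemma triple_EL r1 r2 r3 : T r1 -> T r2 -> T r3 -> (r1 * r2 * r3)%g = w ->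
  [/\ r1 = s i, r2 = s j & r3 = s k] \/
  lex_lt prec [:: s i; s j; s k] [:: r1; r2;
    r3] /\ ~~ (prec r1 r2 && prec r2 r3).
Proof.
move=> T1 T2 T3 ew.
have [b1 h1 q1] := positive_root T1; have [b2 h2 q2] := positive_root T2.
have [b3 h3 q3] := positive_root T3.
have hr : factor3 r1 b1 r2 b2 r3 b3 by split.
have Ts l : T (s l) by exact: root_reflection (root_gen Hq l).
have [irr tr _] := prec_order.
have [e1|l1] := first_reflection_le (factor3_R0 hr).
  have e23 : (r2 * r3 = s j * s k)%g.
    by apply: (mulgI r1); rewrite mulgA ew w_ijk e1 mulgA.
  have [_ _ hc ewc] := factor3_rotate hf.
  have [v1 [v2 [_ _ ex px hx]]] :=
    pair_EL (Ts j) (Ts k) (root_reflection hc) ewc.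
  have [[ej ek]|[_]] := hx _ _ (Ts j) (Ts k) erefl; last by rewrite prec_jk.
  have [[-> ->]|[l2 n23]] := hx _ _ T2 T3 e23; first by left.
  right; split; last by rewrite (negbTE n23) andbF.
  by rewrite /= e1 eqxx ej l2 !orbT.
right; rewrite /= l1; split=> //; apply/negP => /andP [p12 p23].
have R1 := factor3_R0 hr; have R2 := factor3_R0' hr.
have hr13 := factor3_swap hr; have R3 := factor3_R0' hr13.
have p13 := tr _ _ _ R1 R2 R3 p12 p23.
have Ri := factor3_R0 hf.
have no r : R0 r -> prec r1 r -> r = s i -> False.
  by move=> Rr pr er; apply: (prec_asym Ri R1 l1); rewrite -er.
have [] := obtuse_factor3_first hr q1 q2 q3 (factor3_prec_obtuse hr q1 q2 p12)
  (factor3_prec_obtuse hr13 q1 q3 p13)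
  (factor3_prec_obtuse (factor3_rotate hr) q2 q3 p23).
- by move=> er; have := irr _ Ri; rewrite -{2}er l1.
- exact: no R2 p12.
- exact: no R3 p13.
Qed.

End IncreasingCoxeter.

(** By the length of [u], which is at most 3. If it is 2, the reflection [u^-1 * w] completes each
    factorization of [u] to one of [w]. *)
Lemma factorization_EL u : nc_interval T w u ->
  exists a, [/\ minimal_factorization T u a,
    sorted prec a,
    forall d, minimal_factorization T u d -> sorted prec d -> d = a &
    forall d, minimal_factorization T u d -> d <> a -> lex_lt prec a d].
Proof.
rewrite /nc_interval /abs_le /= lenT_w => hu.
case: (ltngtP (lenT u) 1%N) => [u0|u2|u1]; last 1 first.
- have Tu := word_length_eq1 reflections_generate u1.
  have only d : minimal_factorization T u d -> d = [:: u].
    case=> -[_]; rewrite u1; case: d => [|r [|//]] //=.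
    by rewrite big_seq1 => ->.
  exists [:: u]; split=> // [||d hd nd]; last by case: nd; exact: only.
    split; last by rewrite u1.
    by split; [move=> r; rewrite inE => /eqP -> | rewrite big_seq1].
  by move=> d /only.
- have e1 : u = 1%g.
    by apply: (word_length_eq0 reflections_generate); case: (lenT u) u0.
  have l0 := word_length1 reflections_generate.
  have only d : minimal_factorization T u d -> d = [::].
    by rewrite e1 => -[_]; rewrite l0 => /size0nil.
  exists [::]; split=> // [||d hd nd]; last by case: nd; exact: only.
    by rewrite e1; split; [exact: factorization1 | rewrite l0].
  by move=> d /only.
have [a [[Ta ea] la]] := minimal_factorization_exists reflections_generate u.
have [u2'|u3] : lenT u = 2%N \/ lenT u = 3%N.
  by move: hu u2; case: (lenT u) => [|[|[|[|]]]] //; [left | right].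
- have l1 : lenT (u^-1 * w)%g = 1%N by move: hu; rewrite u2';
  case: (lenT (u^-1 * w)%g) => [|[|]].
  have T3 := word_length_eq1 reflections_generate l1.
  move: Ta ea la; rewrite u2'; case: a => [|t1 [|t2 [|//]]] //= Ta.
  rewrite big_cons big_seq1 => eu _.
  have T1 : T t1 by apply: Ta; rewrite mem_head.
  have T2 : T t2 by apply: Ta; rewrite !inE eqxx orbT.
  have ew : (t1 * t2 * (u^-1 * w) = w)%g by rewrite eu mulKVg.
  have [v1 [v2 [V1 V2 ev pv hv]]] := pair_EL T1 T2 T3 ew.
  rewrite eu in ev hv.
  have pairs d : minimal_factorization T u d -> exists r1 r2,
      [/\ d = [:: r1; r2], T r1, T r2 & (r1 * r2)%g = u].
    case=> -[Tb ed]; rewrite u2'; case: d Tb ed => [|r1 [|r2 [|//]]] //= Tb.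
    rewrite big_cons big_seq1 => ed _; exists r1, r2; split=> //.
      by apply: Tb; rewrite mem_head.
    by apply: Tb; rewrite !inE eqxx orbT.
  exists [:: v1; v2]; split=> [||d|d] /=.
  + split; last by rewrite u2'.
    split; last by rewrite big_cons big_seq1.
    by move=> x; rewrite !inE => /orP [] /eqP ->.
  + by rewrite pv.
  + move=> /pairs [r1 [r2 [-> R1 R2 er]]] /=; rewrite andbT => pr.
    by have [[-> ->]//|[_]] := hv _ _ R1 R2 er; rewrite pr.
  move=> /pairs [r1 [r2 [-> R1 R2 er]]] nr /=.
  by have [[e1 e2]|[-> _]//] := hv _ _ R1 R2 er; case: nr; rewrite e1 e2.
have l0 : lenT (u^-1 * w)%g = 0%N by move: hu; rewrite u3;
  case: (lenT (u^-1 * w)%g).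
have ew : u = w.
  have := word_length_eq0 reflections_generate l0 => /(canRL (mulKg _)).
  by rewrite invgK mulg1.
have [i [j [k [ij ik jk wijk [pij pjk]]]]] := increasing_coxeter.
have EL := triple_EL ij ik jk wijk pij pjk.
have triples d : minimal_factorization T u d -> exists r1 r2 r3,
    [/\ d = [:: r1; r2; r3], T r1, T r2, T r3 & (r1 * r2 * r3)%g = w].
  case=> -[Tb ed]; rewrite u3.
  case: d Tb ed => [|r1 [|r2 [|r3 [|//]]]] //= Tb.
  rewrite !big_cons big_nil mulg1 mulgA ew => ed _; exists r1, r2, r3;
    split=> //.
  - by apply: Tb; rewrite mem_head.
  - by apply: Tb; rewrite !inE eqxx orbT.
  - by apply: Tb; rewrite !inE eqxx !orbT.
have Ts l : T (s l) by exact: root_reflection (root_gen Hq l).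
exists [:: s i; s j; s k]; split=> [||d|d].
- split; last by rewrite u3.
  split; last by rewrite !big_cons big_nil mulg1 mulgA ew.
  by move=> x; rewrite !inE => /or3P [] /eqP ->.
- by rewrite /= pij pjk.
- move=> /triples [r1 [r2 [r3 [-> R1 R2 R3 er]]]] /=; rewrite andbT => pr.
  by have [[-> -> ->]//|[_]] := EL _ _ _ R1 R2 R3 er; rewrite pr.
move=> /triples [r1 [r2 [r3 [-> R1 R2 R3 er]]]] nr.
by have [[e1 e2 e3]|[//]] := EL _ _ _ R1 R2 R3 er; case: nr; rewrite e1 e2 e3.
Qed.

End Axis.

(** * The chamber of a point of the axis *)

Section HyperbolicFunctions.
Variable R : realType.
Implicit Types t u : R.

Lemma coshD t u : cosh (t + u) = cosh t * cosh u + sinh t * sinh u.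
Proof.
rewrite /cosh /sinh opprD !expRD.
set a := expR t; set b := expR u; set c := expR (- t); set d := expR (- u).
by field.
Qed.

Lemma sinhD t u : sinh (t + u) = sinh t * cosh u + cosh t * sinh u.
Proof.
rewrite /cosh /sinh opprD !expRD.
set a := expR t; set b := expR u; set c := expR (- t); set d := expR (- u).
by field.
Qed.

Lemma cosh_sinh t : cosh t ^+ 2 - sinh t ^+ 2 = 1.
Proof.
rewrite -[RHS](expRxMexpNx_1 t) /cosh /sinh.
by set a := expR t; set b := expR (- t); field.
Qed.

Lemma sinh_gt0 t : 0 < t -> 0 < sinh t.
Proof.
move=> t0; rewrite /sinh divr_gt0 // subr_gt0 ltr_expR.
by rewrite (lt_trans _ t0) // oppr_lt0.
Qed.

Lemma cosh_gt1 t : 0 < t -> 1 < cosh t.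
Proof.
move=> /sinh_gt0 s0.
have c0 : 0 < cosh t by rewrite divr_gt0 ?addr_gt0 ?expR_gt0.
rewrite -(ltr_pXn2r (_ : (0 < 2)%N)) ?nnegrE ?ler01 ?(ltW c0) // expr1n.
by rewrite -(cosh_sinh t) ltrBlDr ltrDl exprn_gt0.
Qed.

Lemma exists_expr_gt (k c : R) : 1 < k -> exists n, c < k ^+ n.
Proof.
move=> k1; have bern n : 1 + n%:R * (k - 1) <= k ^+ n.
  elim: n => [|n IH]; first by rewrite mul0r addr0 expr0.
  have n0 : 0 <= n%:R * (k - 1) * (k - 1) :> R by rewrite !mulr_ge0 //; lra.
  have := ler_wpM2r (_ : 0 <= k) IH; rewrite -exprSr => h.
  apply: le_trans (h _); last lra.
  rewrite -[n.+1]addn1 natrD; lra.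
pose d := `|c| / (k - 1); have d0 : 0 <= d by rewrite divr_ge0 ?normr_ge0 //;
  lra.
exists (Num.bound d); apply: lt_le_trans (bern _).
have := archi_boundP d0; rewrite /d ltr_pdivrMr ?subr_gt0 // => h.
have := ler_norm c; lra.
Qed.

End HyperbolicFunctions.

(** The reverse Cauchy-Schwarz inequality on one sheet of the hyperboloid. *)
Lemma lform_hplane (R : realType) (x y : 'cV[R]_3) :
  hplane x -> hplane y -> lform x y < 0.
Proof.
rewrite /hplane /lform /= => -[xx x2] [yy y2].
set a := x 0 0 in xx *; set b := x 1 0 in xx *; set c := x ord_max 0 in xx x2 *.
set a' := y 0 0 in yy *; set b' := y 1 0 in yy *;
  set c' := y ord_max 0 in yy y2 *.
rewrite subr_lt0 ltNge; apply/negP => h.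
have h0 : 0 < c * c' by rewrite mulr_gt0.
have : (c * c') ^+ 2 <= (a * a' + b * b') ^+ 2.
  by rewrite ler_pXn2r // nnegrE ltW // (lt_le_trans h0).
have e1 : c ^+ 2 = a ^+ 2 + b ^+ 2 + 1 by rewrite !expr2; lra.
have e2 : c' ^+ 2 = a' ^+ 2 + b' ^+ 2 + 1 by rewrite !expr2; lra.
rewrite exprMn e1 e2.
have := sqr_ge0 (a * b' - b * a'); have := sqr_ge0 a; have := sqr_ge0 b.
have := sqr_ge0 a'; have := sqr_ge0 b'; rewrite !expr2; lra.
Qed.

(** * Change of the base chamber *)

Section Conjugation.
Variables (R : realType) (m : 'I_3 -> 'I_3 -> option nat).
Variables (W : groupType) (s : 'I_3 -> W) (nu : 'I_3 -> 'cV[R]_3).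
Variables (rho : W -> 'M[R]_3) (x0 : 'cV[R]_3).
Hypothesis H : chamber_rep m s nu rho x0.
Variable g : W.
Notation s' := (fun i => g * s i * g^-1)%g.
Notation nu' := (fun i => rho g *m nu i).

Lemma conj_gen_prod (a : seq 'I_3) :
  (\prod_(i <- a) s' i = g * \prod_(i <- a) s i * g^-1)%g.
Proof.
elim: a => [|i a IH]; first by rewrite !big_nil mulg1 mulgV.
by rewrite !big_cons IH !mulgA mulgKV.
Qed.

Lemma chamber_rep_conj y : (forall i, lform y (nu' i) < 0) ->
  chamber_rep m s' nu' rho y.
Proof.
move=> hy; split=> //; first exact: rep_matrix H.
- move=> h; have [a ha] := rep_generated H (g^-1 * h * g)%g.
  by exists a; rewrite conj_gen_prod -ha !mulgA mulgV mul1g mulgK.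
- move=> i j k /(rep_relations H) hk.
  have -> : (g * s i * g^-1 * (g * s j * g^-1) = (s i * s j) ^ g^-1)%g.
    by rewrite conjgE invgK !mulgA mulgKV.
  by rewrite -conjXg hk conj1g.
- have [sg sgM sgs] := rep_sign H; exists sg => // i; rewrite !sgM sgs.
  have sg1 : sg 1%g = false by have := sgM 1%g 1%g; rewrite mulg1;
    case: (sg 1%g).
  by have := sgM g g^-1%g; rewrite mulgV sg1; case: (sg g); case: (sg _).
- by move=> i; rewrite (rho_isom H) (rep_unit H).
- by move=> i j ij; rewrite (rho_isom H) (rep_angle H ij).
have [r1 rM _] := rep_action H; split=> // i x.
exact: (root_act H x (root_conj H g (root_gen H i))).
Qed.

Lemma reflections_conj : reflections s' = reflections s.
Proof.
apply/seteqP; split=> r [h [i ->]].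
  by exists (g^-1 * h)%g, i; rewrite !conjgE !invMg !invgK !mulgA.
by exists (g * h)%g, i; rewrite !conjgE !invMg !mulgA !mulgKV.
Qed.

End Conjugation.

Section AxisInCone.
Variables (R : realType) (m : 'I_3 -> 'I_3 -> option nat).
Variables (W : groupType) (s : 'I_3 -> W) (nu : 'I_3 -> 'cV[R]_3).
Variables (rho : W -> 'M[R]_3) (w : W) (x0 q e : 'cV[R]_3) (ch sh : R).
Notation B := (@lform R).
Hypothesis H : chamber_rep m s nu rho x0.
Hypothesis indep : gram (nu 0) (nu 1) (nu ord_max) != 0.
Hypotheses (qq : B q q = -1) (ee : B e e = 1) (qe : B q e = 0).
Hypotheses (ch_sh : ch ^+ 2 - sh ^+ 2 = 1) (sh_gt0 : 0 < sh) (ch_gt1 : 1 < ch).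
Hypothesis wq : rho w *m q = ch *: q + sh *: e.
Hypothesis we : rho w *m e = sh *: q + ch *: e.
Hypothesis wn : forall x, B x q = 0 -> B x e = 0 -> rho w *m x = - x.
Hypotheses (x00 : B x0 x0 = -1) (x0q : B x0 q < 0).

(* The convex hull of the orbit under the powers of [w] of the midpoint of [x0]
   and [w x0] is the axis. *)
Lemma axis_in_tits_cone : tits_cone nu rho q.
Proof.
have ch1 := ch_gt1; have sh0 := sh_gt0.
(* The isotropic eigenvectors of [w], spanning the ends of the axis, with mutually inverse
   eigenvalues [l] and [l']. *)
pose f : 'cV[R]_3 := q + e; pose f' : 'cV[R]_3 := q - e.
pose l := ch + sh; pose l' := ch - sh.
have ll : l * l' = 1 by rewrite -ch_sh /l /l'; ring.
have wf : rho w *m f = l *: f.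
  rewrite /f mulmxDr wq we /l; apply/matrixP => i j; rewrite !mxE; ring.
have wf' : rho w *m f' = l' *: f'.
  rewrite /f' mulmxBr wq we /l'; apply/matrixP => i j; rewrite !mxE; ring.
have vf : rho w^-1%g *m f = l' *: f.
  rewrite -[RHS](rhoK H w) -scalemxAr wf scalerA mulrC ll scale1r //.
have vf' : rho w^-1%g *m f' = l *: f'.
  by rewrite -[RHS](rhoK H w) -scalemxAr wf' scalerA ll scale1r.
have pow h k (x : 'cV[R]_3) : rho h *m x = k *: x -> forall n,
  rho (h ^+ n)%g *m x = k ^+ n *: x.
  move=> hx; elim=> [|n IH]; first by rewrite expr0 scale1r; exact: (rho1 H).
  by rewrite expgS (rhoM H) IH -scalemxAr hx scalerA mulrC exprS.
pose a := - B x0 q; pose b := B x0 e.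
have a0 : 0 < a by rewrite oppr_gt0.
pose n0 := x0 - a *: q - b *: e.
have nq : B n0 q = 0 by rewrite /n0 !lformE qq (lformC e q) qe /a; ring.
have ne : B n0 e = 0 by rewrite /n0 !lformE qe ee /b; ring.
have [nn _] : 0 <= B n0 n0 /\ (B n0 n0 = 0 -> n0 = 0).
  by apply: (@lform_orth_timelike _ q); rewrite ?qq ?ltrN10 // lformC.
have enn : B n0 n0 = - 1 + a ^+ 2 - b ^+ 2.
  rewrite /n0 !lformE x00 qq ee qe (lformC q x0) (lformC e x0) (lformC e q) qe.
  rewrite (_ : B x0 q = - a) 1?(_ : B x0 e = b) //; last by rewrite /a opprK.
  by ring.
clearbody a b.
have ab : 0 < (a - b) * (a + b).
  have -> : (a - b) * (a + b) = a ^+ 2 - b ^+ 2 by ring.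
  by move: nn; rewrite enn; lra.
have [amb apb] : 0 < a - b /\ 0 < a + b.
  have [h|h] := ltP 0 (a - b); first by move: ab; rewrite pmulr_rgt0.
  have h2 : 0 <= a + b by move: h; rewrite subr_le0 => h;
    rewrite addr_ge0 // ltW // (lt_le_trans a0).
  by move: ab; rewrite ltNge mulr_le0_ge0.
have sh_ch : 0 < ch - sh.
  have : 0 < (ch - sh) * (ch + sh).
    by rewrite (_ : _ * _ = 1) // -ch_sh; ring.
  by rewrite pmulr_lgt0 // addr_gt0 // (lt_trans _ ch_gt1).
pose A := (a + b) * (1 + l) / 2; pose A' := (a - b) * (1 + l') / 2.
have A0 : 0 < A by rewrite /A divr_gt0 // mulr_gt0 // /l; lra.
have A'0 : 0 < A' by rewrite /A' divr_gt0 // mulr_gt0 // /l'; lra.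
pose p := x0 + rho w *m x0.
have ep : p = A *: f + A' *: f'.
  have wx : rho w *m x0 = a *: (rho w *m q) + b *: (rho w *m e) - n0.
    rewrite -(wn nq ne) {1}(_ : x0 = a *: q + b *: e + n0); last first.
      by rewrite /n0; apply/matrixP => i j; rewrite !mxE; ring.
    by rewrite !mulmxDr -!scalemxAr.
  rewrite /p wx wq we /n0 /A /A' /f /f' /l /l'.
  by apply/matrixP => i j; rewrite !mxE; field.
have pc : tits_cone nu rho p.
  by apply: (tits_cone_segment H); move=> i; apply/ltW/(rep_inside H).
have l1 : 1 < l by rewrite /l; lra.
(* For large [n] both coefficients of the combination of [w ^+ n] and [w^-1 ^+ n] applied to [p]
   below are positive; they are chosen to balance the components along [f] and [f'], leaving a
   multiple of [q]. *)
have [n hn] := exists_expr_gt (A / A' + A' / A + 1) l1.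
have l'n : l' ^+ n <= 1.
  by apply: exprn_ile1; [exact: ltW | move: ll l1 sh_ch; rewrite -/l'; nra].
have lln : l ^+ n * l' ^+ n = 1 by rewrite -exprMn ll expr1n.
have d1 : 0 < A / A' by rewrite divr_gt0.
have d2 : 0 < A' / A by rewrite divr_gt0.
have c1 : 0 < A' * l ^+ n - A * l' ^+ n.
  have : A / A' < l ^+ n by lra.
  rewrite ltr_pdivrMr // mulrC => h.
  by have := ler_piMr (ltW A0) l'n; lra.
have c2 : 0 < A * l ^+ n - A' * l' ^+ n.
  have : A' / A < l ^+ n by lra.
  rewrite ltr_pdivrMr // mulrC => h.
  by have := ler_piMr (ltW A'0) l'n; lra.
have : tits_cone nu rho
    ((A' * l ^+ n - A * l' ^+ n) *: (rho (w ^+ n)%g *m p) +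
     (A * l ^+ n - A' * l' ^+ n) *: (rho (w^-1 ^+ n)%g *m p)).
  apply: (tits_coneD H); apply: (tits_coneZ (ltW _)) => //;
    exact: (tits_cone_act H).
pose k := A * A' * ((l ^+ n) ^+ 2 - (l' ^+ n) ^+ 2).
rewrite (_ : _ + _ = (2 * k) *: q); last first.
  rewrite ep !mulmxDr -!scalemxAr !(pow _ _ _ wf) !(pow _ _ _ wf').
  rewrite !(pow _ _ _ vf) !(pow _ _ _ vf') /f /f' /k.
  have e1 : (l ^+ n) * (l' ^+ n) = 1 by [].
  apply/matrixP => i j; rewrite !mxE.
  set x := l ^+ n in e1 *; set y := l' ^+ n in e1 *.
  ring: e1.
have ln : 1 < l ^+ n by lra.
have d3 : 0 < (l ^+ n) ^+ 2 - (l' ^+ n) ^+ 2.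
  rewrite subr_gt0 ltr_pXn2r ?nnegrE ?exprn_ge0 ?(ltW sh_ch)
    ?(ltW (lt_trans ltr01 l1)) //.
  exact: le_lt_trans l'n ln.
have k0 : 0 < 2 * k by apply: mulr_gt0 => //; apply: mulr_gt0 => //;
  exact: mulr_gt0.
move=> /(tits_coneZ (_ : 0 <= (2 * k)^-1)); rewrite scalerA mulVf ?gt_eqF //.
by rewrite scale1r; apply; rewrite invr_ge0 ltW.
Qed.

End AxisInCone.

Lemma coxeter_sign (m : 'I_3 -> 'I_3 -> option nat) (W : groupType)
    (s : 'I_3 -> W) : coxeter_system m s ->
  exists2 sg : W -> bool,
    {morph sg : x y / (x * y)%g >-> x (+) y} & forall i, sg (s i) = true.
Proof.
move=> [_ _ _ univ].
(* The group of order two is realized as the permutations of two points, and every generator is sent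
   to the transposition. *)
pose t : {perm 'I_2} := tperm ord0 ord_max.
have rel : coxeter_relations m (fun _ : 'I_3 => t).
  by move=> i j k _; rewrite /t tperm2 expg1n.
have [phi phiM phis] := univ _ _ rel.
exists (fun g => odd_perm (phi g)).
  by move=> x y; rewrite phiM odd_permM.
by move=> i; rewrite phis /t odd_tperm.
Qed.

Lemma glide_axis_action (R : realType) (A : 'M[R]_3) (q e : 'cV[R]_3) :
  glide_axis A q e -> exists ch sh : R, [/\ ch ^+ 2 - sh ^+ 2 = 1, 0 < sh,
    1 < ch,
    A *m q = ch *: q + sh *: e & A *m e = sh *: q + ch *: e].
Proof.
move=> [_ [tau tau0 hA] _]; exists (cosh tau), (sinh tau).
have c0 : cosh 0 = 1 :> R by rewrite /cosh oppr0 expR0; field.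
have s0 : sinh 0 = 0 :> R by rewrite /sinh oppr0 expR0 subrr mul0r.
have Aq : A *m q = cosh tau *: q + sinh tau *: e.
  by have := hA 0; rewrite /geodesic c0 s0 scale1r scale0r addr0 add0r.
split=> //; [exact: cosh_sinh | exact: sinh_gt0 | exact: cosh_gt1 |].
have s1 : sinh 1 != 0 :> R by rewrite gt_eqF // sinh_gt0.
(* The image of [q] comes from the point at time 0; that of [e] is then isolated at time 1, dividing
   by [sinh 1]. *)
have := hA 1; rewrite /geodesic mulmxDr -!scalemxAr Aq coshD sinhD => h.
apply: (scalerI s1); apply/matrixP => i j; move/matrixP/(_ i j): h.
rewrite !mxE => h; lra.
Qed.

Theorem theorem4p15 (R : realType) (m : 'I_3 -> 'I_3 -> option nat)
    (W : groupType) (s : 'I_3 -> W)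
    (nu : 'I_3 -> 'cV[R]_3) (rho : W -> 'M[R]_3)
    (w : W) (q e : 'cV[R]_3) (C0 : set 'cV[R]_3) (prec : rel W) :
  coxeter_system m s -> hyperbolic m ->
  hyperbolic_triangle m nu -> reflection_action s nu rho ->
  coxeter_element s w -> glide_axis (rho w) q e ->
  axial_chamber (reflections s) rho q e C0 -> C0 q ->
  axial_ordering (reflections s) rho w q e prec ->
  EL_labeling (nc_interval (reflections s) w) (abs_le (reflections s))
    (interval_reflections (reflections s) w) prec (@natural_label W) /\
  (forall u : W, nc_interval (reflections s) w u ->
    exists a, [/\ minimal_factorization (reflections s) u a,
      sorted prec a,
      forall b, minimal_factorization (reflections s) u b ->
        sorted prec b -> b = a &
      forall b, minimal_factorization (reflections s) u b -> b <> a ->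
        lex_lt prec a b]).
Proof.
move=> cox _ [nu1 nu2 [x [x_hp x2] xin]] rho_act [sigma ew] glide [[y _ C0y]
  _] C0q.
move=> [prec_order prec_axial].
have [cm gen rel _] := cox.
have genW g : exists a : seq 'I_3, (g = \prod_(i <- a) s i)%g by exact: gen.
have Hx : chamber_rep m s nu rho x.
  by split=> //; exact: coxeter_sign cox.
have [ch [sh [ch_sh sh_gt0 ch_gt1 wq we]]] := glide_axis_action glide.
have [[[qq q2] ee qe] _ wn] := glide.
have w_cox : exists i j k : 'I_3,
    [/\ i != j, i != k, j != k & w = (s i * s j * s k)%g].
  exists (sigma ord0), (sigma (lift ord0 ord0)),
    (sigma (lift ord0 (lift ord0 ord0))).
  rewrite !(inj_eq perm_inj) ew !big_ord_recl big_ord0 mulg1 mulgA; split=> //.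
have g0E := gram0E Hx qq qe ch_sh sh_gt0 ch_gt1 wq we w_cox.
have g0 := gram0_neq0 Hx qq qe ch_sh sh_gt0 ch_gt1 wq we w_cox.
have wn' z : lform z q = 0 -> lform z e = 0 -> rho w *m z = - z by exact: wn.
have [g [p [hp eq]]] : tits_cone nu rho q.
  apply: (axis_in_tits_cone Hx qq ee qe ch_sh sh_gt0 ch_gt1 wq we wn' x_hp).
  exact: lform_hplane.
pose s' i := (g * s i * g^-1)%g; pose nu' i := rho g *m nu i.
(* The point [q] lies in the closed chamber with normals [nu'], and on no mirror because it lies in
   [C0]. *)
have qin i : lform q (nu' i) < 0.
  rewrite lt_neqAle {2}eq (rho_isom Hx) hp andbT; apply/eqP => q0.
  have hr : root_of s nu rho (s' i) (nu' i) := root_conj Hx g (root_gen Hx i).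
  have Cq : mirror_complement (reflections s) rho q.
    by move: C0q; rewrite C0y => /connected_component_sub.
  case: Cq => _; apply; exists (s' i).
    by apply/(reflectionsP s nu rho); exists (nu' i).
  split=> //; rewrite /fixed_space /= (root_act Hx _ hr) /reflect_along q0.
  by rewrite mulr0 scale0r subr0.
have Hq : chamber_rep m s' nu' rho q := chamber_rep_conj Hx qin.
have g0E' : gram (nu' 0) (nu' 1) (nu' ord_max) = (1 - ch) / 2.
  by rewrite -g0E /gram !(rho_isom Hx).
have g0' : gram (nu' 0) (nu' 1) (nu' ord_max) != 0.
  by rewrite g0E' -g0E.
(* The displacement of [q], which lies on the axis, attains the minimum; hence [w] is also a Coxeter
   element for the simple reflections of the chamber of [q]. *)
have w_cox' : exists i j k : 'I_3,
    [/\ i != j, i != k, j != k & w = (s' i * s' j * s' k)%g].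
  apply: (coxeter_of_displacement Hq g0' (p := q)) => //.
    have [i [j [k [ij ik jk wijk]]]] := w_cox => z.
    rewrite wijk (root_act3 Hx z (root_gen Hx i) (root_gen Hx j)
      (root_gen Hx k)).
    by apply: triple_reflection_fixed;
      rewrite ?nu1 // (gram_distinct _ ij ik jk).
  by rewrite g0E' wq !lformE qq qe; field.
have eT : reflections s' = reflections s := reflections_conj s g.
(* The claim depends on the generators only through the set of reflections, so they may be replaced
   by those of the chamber of [q]. *)
rewrite -eT in prec_order prec_axial *.
have EL :=
  factorization_EL Hq qq ee qe ch_sh sh_gt0 ch_gt1 wq we w_cox' Hq
    prec_order prec_axial.
have gT := reflections_generate Hq; have TJ := reflectionsJ (s := s').
have EL' := EL_labeling_of_factorizations gT TJ EL.
by split; [exact: EL' | exact: EL].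
Qed.
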